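(* Let $\Lambda\subset\mathbb{C}$ be a lattice of covolume $\frac\pi2$, let $N\ge1$ be an integer, let $\alpha_1,\ldots,\alpha_N\in\mathbb{C}$ and $\beta>0$. Then the monic pseudopolynomial $\Pi_{\boldsymbol\alpha}=\prod_{j=1}^N\pi_{\alpha_j}$ satisfies $$\frac\pi2\,\mathrm{e}^{N\beta A_\Lambda}\,\varTheta_{N,\beta}(\mathbb{C}/\Lambda)\le\|\Pi_{\boldsymbol\alpha}\|_{L^\beta}^\beta\le\frac\pi2\,\mathrm{e}^{N\beta A_\Lambda}\,E(\beta N,\Lambda).$$
   Context: A lattice $\Lambda=\omega_1\mathbb{Z}+\omega_2\mathbb{Z}\subset\mathbb{C}$ is a discrete additive subgroup with two $\mathbb{R}$-linearly independent generators; its covolume is the area of a fundamental parallelogram. $\mathrm{dA}$ is area measure on $\mathbb{C}$, also used on $\mathbb{C}/\Lambda$. Let $\sigma$ be the Weierstrass sigma function of $\Lambda$, $$\sigma(z)=z\prod_{0\ne\omega\in\Lambda}\Big(1-\frac z\omega\Big)\exp\Big\{\frac z\omega+\frac{z^2}{2\omega^2}\Big\}.$$ The modified sigma function is $\sigma_\ast(z)=\mathrm{e}^{bz^2}\sigma(z)$, where $b\in\mathbb{C}$ is the unique constant such that $\mathrm{e}^{-|z|^2}|\sigma_\ast(z)|$ is $\Lambda$-periodic (it exists because the covolume is $\frac\pi2$; if the generators are chosen with $\omega_1>0$ and $\operatorname{Im}\omega_2>0$, then $b=1-\frac{\lambda_1}{2\omega_1}$ with $\lambda_1=2\zeta(\omega_1/2)$,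 $\zeta=\sigma'/\sigma$). Put $$A_\Lambda=\frac2\pi\int_{\mathbb{C}/\Lambda}(\log|\sigma_\ast(z)|-|z|^2)\,\mathrm{dA}(z),\qquad U_{\mathbb{C}/\Lambda}(z,w)=\log|\sigma_\ast(z-w)|-|z-w|^2-A_\Lambda.$$ The packing number is $$\varTheta_{N,\beta}(\mathbb{C}/\Lambda)=\inf_{w_1,\ldots,w_N\in\mathbb{C}}\frac2\pi\int_{\mathbb{C}/\Lambda}\exp\big(\beta U_{\mathbb{C}/\Lambda}(z,w_1)+\cdots+\beta U_{\mathbb{C}/\Lambda}(z,w_N)\big)\,\mathrm{dA}(z),$$ and for $\beta>0$ $$E(\beta,\Lambda)=\frac2\pi\int_{\mathbb{C}/\Lambda}\exp(\beta U_{\mathbb{C}/\Lambda}(z,0))\,\mathrm{dA}(z).$$ The first degree monic pseudopolynomial with root $\alpha\in\mathbb{C}$ is $$\pi_\alpha(z)=\mathrm{e}^{2\mathrm{i}\operatorname{Im}(\bar\alpha z)}\,\mathrm{e}^{-|z-\alpha|^2}\sigma_\ast(z-\alpha),\qquad z\in\mathbb{C},$$ and for $\boldsymbol\alpha=(\alpha_1,\ldots,\alpha_N)$, $\Pi_{\boldsymbol\alpha}(z)=\pi_{\alpha_1}(z)\cdots\pi_{\alpha_N}(z)$. The modulus $|\Pi_{\boldsymbol\alpha}|$ is $\Lambda$-periodic, and $$\|\Pi_{\boldsymbol\alpha}\|_{L^\beta}^\beta=\int_{\mathbb{C}/\Lambda}|\Pi_{\boldsymbol\alpha}(z)|^\beta\,\mathrm{dA}(z).$$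 *)

(* Defs.v *)
From mathcomp Require Import all_boot all_order all_algebra.
From mathcomp Require Import all_classical all_reals all_analysis.
From mathcomp Require Export complex.
Import Order.TTheory GRing.Theory Num.Theory.
Import numFieldNormedType.Exports.

Set Implicit Arguments.
Unset Strict Implicit.
Unset Printing Implicit Defensive.

Local Open Scope classical_set_scope.
Local Open Scope ring_scope.

Local Notation normc := Normc.normc.
Local Notation area :=
  (@lebesgue_measure _ \x @lebesgue_measure _)%E.

Definition cexp (R : realType) (z : R[i]) : R[i] :=
  (expR (complex.Re z))%:C%C *
  (cos (complex.Im z) +i* sin (complex.Im z))%C.

Record lattice (R : realType) := Lattice {
  gen1 : R[i];
  gen2 : R[i];
  gen_independent : forall s t : R,
    s%:C%C * gen1 + t%:C%C * gen2 = 0 -> s = 0 /\ t = 0 }.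

Section Lattice.
Context {R : realType}.
Variable L : lattice R.

Definition lattice_point (m n : int) : R[i] :=
  m%:~R * gen1 L + n%:~R * gen2 L.

Definition lattice_set : set R[i] :=
  [set w | exists m n : int, w = lattice_point m n].

(* A half-open fundamental domain, in the coordinates (Re z, Im z). *)
Definition fund_parallelogram : set (R * R) :=
  [set p | exists s t : R, [/\ 0 <= s < 1, 0 <= t < 1 &
     (p.1 +i* p.2)%C = s%:C%C * gen1 L + t%:C%C * gen2 L]].

Definition covolume : \bar R := area fund_parallelogram.

(* The integral over C/Lambda of a Lambda-periodic function f. *)
Definition torus_integral (f : R[i] -> \bar R) : \bar R :=
  (\int[area]_(p in fund_parallelogram) f (p.1 +i* p.2)%C)%E.

(* The product defining sigma converges absolutely, so it may be exhausted by
   the squares |m|, |n| <= k: the index i < 2k+1 stands for the integer i - k. *)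
Definition sigma_partial (z : R[i]) (k : nat) : (R[i])^o :=
  z * \prod_(i < k.*2.+1)
        \prod_(j < k.*2.+1 | lattice_point (i%:Z - k%:Z) (j%:Z - k%:Z) != 0)
          let w := lattice_point (i%:Z - k%:Z) (j%:Z - k%:Z) in
          (1 - z / w) * cexp (z / w + z ^+ 2 / (2 * w ^+ 2)).

Definition weierstrass_sigma (z : R[i]) : R[i] :=
  lim (sigma_partial z @ \oo).

Definition modified_sigma_const_spec : set R[i] :=
  [set b | forall z w : R[i], lattice_set w ->
     let f u := expR (- normc u ^+ 2) *
                normc (cexp (b * u ^+ 2) * weierstrass_sigma u) in
     f (z + w) = f z].

(* Exactly one constant satisfies the specification when the covolume is pi/2;
   the default value 0 is then never used. *)
Definition modified_sigma_const : R[i] := xget 0 modified_sigma_const_spec.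

Definition modified_sigma (z : R[i]) : R[i] :=
  cexp (modified_sigma_const * z ^+ 2) * weierstrass_sigma z.

(* log|sigma_*(z)| - |z|^2, equal to -oo at the lattice points *)
Definition log_modified_sigma (z : R[i]) : \bar R :=
  (lne (normc (modified_sigma z))%:E - (normc z ^+ 2)%:E)%E.

(* The integrand is integrable, so [fine] discards nothing. *)
Definition A_const : R :=
  2 / pi * fine (torus_integral log_modified_sigma).

Definition torus_potential (z w : R[i]) : \bar R :=
  (log_modified_sigma (z - w)%R - A_const%:E)%E.

Definition packing_number (N : nat) (beta : R) : \bar R :=
  ereal_inf [set ((2 / pi)%:E * torus_integral (fun z : R[i] =>
      expeR (\sum_(j < N) beta%:E * torus_potential z (w j))%E))%E
    | w in [set: 'I_N -> R[i]]].

Definition E_const (beta : R) : \bar R :=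
  ((2 / pi)%:E * torus_integral (fun z : R[i] =>
      expeR (beta%:E * torus_potential z 0%R)))%E.

Definition pseudopoly1 (alpha z : R[i]) : R[i] :=
  cexp (2 * 'i%C * (complex.Im (alpha^*%C * z))%:C%C) *
  (expR (- normc (z - alpha) ^+ 2))%:C%C * modified_sigma (z - alpha).

Definition pseudopoly (N : nat) (alpha : 'I_N -> R[i]) (z : R[i]) : R[i] :=
  \prod_(j < N) pseudopoly1 (alpha j) z.

(* ||f||_{L^beta}^beta over C/Lambda, for |f| Lambda-periodic *)
Definition torus_Lnorm_pow (beta : R) (f : R[i] -> R[i]) : \bar R :=
  torus_integral (fun z : R[i] => (normc (f z) `^ beta)%:E).

End Lattice.

(* Main.v *)
From HB Require Import structures.
Require Import Defs.
From mathcomp Require Import all_boot all_order all_algebra.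
From mathcomp Require Import all_classical all_reals all_analysis.
From mathcomp Require Import measurable_realfun ring lra zify.
Import Order.TTheory GRing.Theory Num.Theory.
Import numFieldNormedType.Exports.
Import Normc.

Set Implicit Arguments.
Unset Strict Implicit.
Unset Printing Implicit Defensive.

Local Open Scope classical_set_scope.
Local Open Scope ring_scope.
Local Notation Re := complex.Re.
Local Notation Im := complex.Im.

(** Put f(z) = exp(-|z|^2) |sigma_*(z)|.  Then |pi_alpha(z)| = f(z - alpha) and
    U(z, w) = log f(z - w) - A, so the integral of |Pi_alpha|^beta is
    e^(N beta A) times the integral of exp(beta sum_j U(z, alpha_j)), which is
    one of the competitors in the infimum that defines the packing number.
    This gives the lower bound ([packing_number_le]).

    For the upper bound, the inequality between the arithmetic and geometric
    means ([prod_le_mean_pow]) gives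
      prod_j f(z - alpha_j)^beta <= N^-1 sum_j f(z - alpha_j)^(beta N),
    and since f is periodic, each of the N terms on the right has the same
    integral over a fundamental domain as f^(beta N)
    ([torus_integral_translate]); that common value is the one that E measures
    ([pseudopoly_Lnorm_le]).

    The main work is the periodicity of f, that is, the existence of the
    constant b in sigma_*(z) = e^(b z^2) sigma(z)
    ([modified_sigma_const_ex]).  Let sigma_k be the product over the square of
    lattice points |m|, |n| <= k.  The products sigma_k converge because the
    factors added in step k, about 8k of them, are 1 + O(k^-3)
    ([sigma_partial_cvg]).  Shifting the argument by a generator w1 shifts the
    square of zeros by one row, so that only two opposite edges of the square
    survive in sigma_k(z + w1) / sigma_k(z); this quotient is
    -exp((2z + w1) c_k) (1 + o(1)) with c_k independent of z
    ([sigma_partial_shift]).  Since sigma has no zero outside the lattice, the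
    c_k converge ([quasi_coef_cvg]), and sigma(z + w1) =
    -exp((2z + w1) c1) sigma(z); similarly with w2 and c2.

    A constant b makes f periodic as soon as b w1 + c1 = conj(w1) and
    b w2 + c2 = conj(w2).  These two equations are compatible exactly when
    w2 c1 - w1 c2 = 2 i d with d = Im(conj(w1) w2).  Legendre's relation says
    that the left-hand side is i pi or -i pi, with the sign of d
    ([legendre_relation]), whereas |d| is the covolume ([covolumeE]), here
    pi / 2.  In the proof of Legendre's relation, oddness of sigma shows that
    the left-hand side is an odd multiple of i pi, and a comparison of the edge
    sums with differences of arctangents confines it to the values between 0
    and 2 i pi (or -2 i pi). *)

(** * The complex exponential and the canonical factors *)

Section ComplexBasics.
Context {R : realType}.
Implicit Types z w : R[i].

Lemma ReD z w : Re (z + w) = Re z + Re w. Proof. by case: z w => ? ? []. Qed.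
Lemma ImD z w : Im (z + w) = Im z + Im w. Proof. by case: z w => ? ? []. Qed.
Lemma ReN z : Re (- z) = - Re z. Proof. by case: z. Qed.
Lemma ImN z : Im (- z) = - Im z. Proof. by case: z. Qed.
Lemma ReM z w : Re (z * w) = Re z * Re w - Im z * Im w.
Proof. by case: z w => ? ? []. Qed.
Lemma ImM z w : Im (z * w) = Re z * Im w + Im z * Re w.
Proof. by case: z w => ? ? []. Qed.

Lemma complex_eq z w : Re z = Re w -> Im z = Im w -> z = w.
Proof. by case: z w => ? ? [? ?] /= -> ->. Qed.

Lemma normcE z : normc z = Num.sqrt (Re z ^+ 2 + Im z ^+ 2).
Proof. by case: z. Qed.

Lemma normc_ge0 z : 0 <= normc z.
Proof. by rewrite normcE sqrtr_ge0. Qed.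

Lemma sqr_normcE z : normc z ^+ 2 = Re z ^+ 2 + Im z ^+ 2.
Proof. by rewrite normcE sqr_sqrtr // addr_ge0 ?sqr_ge0. Qed.

Lemma Re_le_normc z : `|Re z| <= normc z.
Proof.
by rewrite normcE -sqrtr_sqr ler_wsqrtr // lerDl sqr_ge0.
Qed.

Lemma Im_le_normc z : `|Im z| <= normc z.
Proof.
by rewrite normcE -sqrtr_sqr ler_wsqrtr // lerDr sqr_ge0.
Qed.

Lemma normc_real (x : R) : normc x%:C%C = `|x|.
Proof. by rewrite normcE /= expr0n addr0 sqrtr_sqr. Qed.

Lemma normc_le_ReIm z : normc z <= `|Re z| + `|Im z|.
Proof.
rewrite -(@ler_pXn2r _ 2) ?nnegrE ?addr_ge0 ?normc_ge0 // sqr_normcE.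
rewrite -[Re z ^+ 2]real_normK ?num_real // -[Im z ^+ 2]real_normK ?num_real //.
have := normr_ge0 (Re z); have := normr_ge0 (Im z); nra.
Qed.

Lemma normc_eq0 z : (normc z == 0) = (z == 0).
Proof.
apply/eqP/eqP => [/eq0_normc //|->]; by rewrite normcE /= expr0n addr0 sqrtr0.
Qed.

Lemma normc_gt0 z : (0 < normc z) = (z != 0).
Proof. by rewrite lt0r normc_ge0 andbT normc_eq0. Qed.

Lemma normcX z n : normc (z ^+ n) = normc z ^+ n.
Proof.
elim: n => [|n IH]; last by rewrite !exprS normcM IH.
by rewrite !expr0 normc1.
Qed.

Lemma normc_prod I (r : seq I) (F : I -> R[i]) :
  normc (\prod_(i <- r) F i) = \prod_(i <- r) normc (F i).
Proof. by elim/big_rec2: _ => [|i x y _ <-]; rewrite ?normc1 // normcM. Qed.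

Lemma cexp0 : cexp (0 : R[i]) = 1.
Proof. by rewrite /cexp /= expR0 cos0 sin0 mul1r. Qed.

Lemma cexpD z w : cexp (z + w) = cexp z * cexp w.
Proof.
rewrite /cexp ReD ImD expRD cosD sinD.
by apply: complex_eq; rewrite /=; ring.
Qed.

Lemma normc_cexp z : normc (cexp z) = expR (Re z).
Proof.
rewrite /cexp normcM normc_real ger0_norm ?expR_ge0 // normcE /=.
by rewrite cos2Dsin2 sqrtr1 mulr1.
Qed.

Lemma cexpNK z : cexp (- z) * cexp z = 1.
Proof. by rewrite -cexpD addNr cexp0. Qed.

Lemma cexp_neq0 z : cexp z != 0.
Proof. by rewrite -normc_gt0 normc_cexp expR_gt0. Qed.

Lemma cexpN z : cexp (- z) = (cexp z)^-1.
Proof.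
by apply: (mulIf (cexp_neq0 z)); rewrite cexpNK mulVf // cexp_neq0.
Qed.

Lemma cexp_sum I (r : seq I) (F : I -> R[i]) :
  cexp (\sum_(i <- r) F i) = \prod_(i <- r) cexp (F i).
Proof.
by elim/big_rec2: _ => [|i x y _ <-]; rewrite ?cexp0 // cexpD.
Qed.

(** Componentwise, since the mean value theorem is one for real functions. *)
Definition is_cderive (f : R -> R[i]) (t : R) (df : R[i]) :=
  is_derive t 1 (fun s => Re (f s)) (Re df) /\
  is_derive t 1 (fun s => Im (f s)) (Im df).

Lemma is_cderive_eq f t d d' : is_cderive f t d -> d = d' -> is_cderive f t d'.
Proof. by move=> ? <-. Qed.

Lemma is_cderive_cst z t : is_cderive (fun=> z) t 0.
Proof. by split => /=; exact: is_derive_cst. Qed.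

Lemma is_cderive_line z t : is_cderive (fun s => s%:C%C * z) t z.
Proof.
split; [have -> : (fun s : R => Re (s%:C%C * z)) = (fun s => s * Re z)
         by apply/funext => s; rewrite ReM /= mul0r subr0
       |have -> : (fun s : R => Im (s%:C%C * z)) = (fun s => s * Im z)
         by apply/funext => s; rewrite ImM /= mul0r addr0];
apply: is_derive_eq; by rewrite /GRing.scale /=; ring.
Qed.

Lemma is_cderiveD f g t df dg : is_cderive f t df -> is_cderive g t dg ->
  is_cderive (fun s => f s + g s) t (df + dg).
Proof.
move=> [f1 f2] [g1 g2]; split.
- under eq_fun do rewrite ReD.
  by apply: is_derive_eq; rewrite ReD.
- under eq_fun do rewrite ImD.
  by apply: is_derive_eq; rewrite ImD.
Qed.

Lemma is_cderiveM f g t df dg : is_cderive f t df -> is_cderive g t dg ->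
  is_cderive (fun s => f s * g s) t (df * g t + f t * dg).
Proof.
move=> [f1 f2] [g1 g2]; split.
- under eq_fun do rewrite ReM.
  by apply: is_derive_eq; rewrite /GRing.scale /= ReD !ReM; ring.
- under eq_fun do rewrite ImM.
  by apply: is_derive_eq; rewrite /GRing.scale /= ImD !ImM; ring.
Qed.

Lemma is_cderive_cexp f t df : is_cderive f t df ->
  is_cderive (fun s => cexp (f s)) t (df * cexp (f t)).
Proof.
move=> [f1 f2].
have d1 := is_derive1_comp (is_derive_expR (Re (f t))) f1.
have d2 := is_derive1_comp (is_derive_cos (Im (f t))) f2.
have d3 := is_derive1_comp (is_derive_sin (Im (f t))) f2.
split.
- have -> : (fun s => Re (cexp (f s))) =
     (fun s => (expR \o (fun s => Re (f s))) s * (cos \o (fun s => Im (f s))) s).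
    by apply/funext => s; rewrite /cexp ReM /= mul0r subr0.
  apply: is_derive_eq; rewrite /cexp /GRing.scale /= ReM ReM ImM /=; ring.
- have -> : (fun s => Im (cexp (f s))) =
     (fun s => (expR \o (fun s => Re (f s))) s * (sin \o (fun s => Im (f s))) s).
    by apply/funext => s; rewrite /cexp ImM /= mul0r addr0.
  apply: is_derive_eq; rewrite /cexp /GRing.scale /= ImM ReM ImM /=; ring.
Qed.

Lemma mvt_bound (g dg : R -> R) (M : R) :
  (forall t : R, is_derive t 1 g (dg t)) ->
  (forall t, 0 <= t <= 1 -> `|dg t| <= M) -> `|g 1 - g 0| <= M.
Proof.
move=> gd gM.
have gc : {within `[0, 1], continuous g}.
  apply: continuous_subspaceT => t; apply: differentiable_continuous.
  by apply/derivable1_diffP; have [] := gd t.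
have [c c01 ->] := MVT (@ltr01 R) (fun t _ => gd t) gc.
rewrite subr0 mulr1 gM //.
by move: c01; rewrite in_itv /= => /andP[/ltW -> /ltW ->].
Qed.

Lemma cmvt_bound (f df : R -> R[i]) (M : R) :
  (forall t, is_cderive f t (df t)) ->
  (forall t, 0 <= t <= 1 -> normc (df t) <= M) ->
  normc (f 1 - f 0) <= M * 2.
Proof.
move=> fd fM; apply: (le_trans (normc_le_ReIm _)).
rewrite mulr_natr mulr2n; apply: lerD.
- rewrite ReD ReN; apply: (mvt_bound (g := fun t => Re (f t)) (dg := fun t => Re (df t))).
    by move=> t; have [] := fd t.
  by move=> t /fM; apply: le_trans; exact: Re_le_normc.
- rewrite ImD ImN; apply: (mvt_bound (g := fun t => Im (f t)) (dg := fun t => Im (df t))).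
    by move=> t; have [] := fd t.
  by move=> t /fM; apply: le_trans; exact: Im_le_normc.
Qed.

(** The canonical factors of genus one and two. *)
Definition canon1 (u : R[i]) := (1 - u) * cexp u.
Definition canon2 (u : R[i]) := (1 - u) * cexp (u + u ^+ 2 / 2).

(** Along the segment from 0 to u, the derivative of (1 - t u) e^(t u) in t is
    -t u^2 e^(t u): the linear terms cancel. *)
Lemma canon1_near1 u : normc u <= 1 ->
  normc (canon1 u - 1) <= expR 1 * 2 * normc u ^+ 2.
Proof.
move=> u1.
pose f (t : R) := (1 + t%:C%C * (- u)) * cexp (t%:C%C * u).
have fd t : is_cderive f t (- (t%:C%C * u ^+ 2) * cexp (t%:C%C * u)).
  apply: is_cderive_eq.
    apply: is_cderiveM (is_cderiveD (is_cderive_cst 1 t) (is_cderive_line _ t)) _.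
    exact: is_cderive_cexp (is_cderive_line _ t).
  cbv beta; ring.
have fM t : 0 <= t <= 1 ->
    normc (- (t%:C%C * u ^+ 2) * cexp (t%:C%C * u)) <= expR 1 * normc u ^+ 2.
  move=> /andP[t0 t1].
  rewrite normcM normcN normcM normc_real ger0_norm // normcX normc_cexp.
  rewrite mulrC ler_pM ?expR_ge0 ?mulr_ge0 ?exprn_ge0 ?normc_ge0 //.
    rewrite ler_expR (le_trans (ler_norm _)) // (le_trans (Re_le_normc _)) //.
    by rewrite normcM normc_real ger0_norm // mulr_ile1 ?normc_ge0.
  by rewrite ler_piMl // exprn_ge0 ?normc_ge0.
move: (cmvt_bound fd fM).
by rewrite /f /canon1 !mul1r !mul0r addr0 cexp0 mulr1 mulrAC.
Qed.

(** The exponent u + u^2 / 2 cancels the quadratic term as well: along the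
    segment from 0 to u the derivative is -t^2 u^3 times the exponential. *)
Lemma canon2_near1 u : normc u <= 1 ->
  normc (canon2 u - 1) <= expR 2 * 2 * normc u ^+ 3.
Proof.
move=> u1.
pose e (t : R) := t%:C%C * u + (t%:C%C * (u / 2)) * (t%:C%C * u).
pose f (t : R) := (1 + t%:C%C * (- u)) * cexp (e t).
pose df (t : R) := - (t%:C%C ^+ 2 * u ^+ 3) * cexp (e t).
have fd t : is_cderive f t (df t).
  apply: is_cderive_eq.
    apply: is_cderiveM (is_cderiveD (is_cderive_cst 1 t) (is_cderive_line _ t)) _.
    apply: is_cderive_cexp.
    apply: is_cderiveD; first exact: is_cderive_line.
    by apply: is_cderiveM; exact: is_cderive_line.
  by rewrite /df /e; cbv beta; field.
have fM t : 0 <= t <= 1 -> normc (df t) <= expR 2 * normc u ^+ 3.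
  move=> /andP[t0 t1].
  have tu : normc (t%:C%C * u) <= 1.
    by rewrite normcM normc_real ger0_norm // mulr_ile1 ?normc_ge0.
  rewrite normcM normcN normcM normc_cexp !normcX normc_real ger0_norm //.
  rewrite mulrC ler_pM ?expR_ge0 ?mulr_ge0 ?exprn_ge0 ?normc_ge0 //.
    rewrite ler_expR (le_trans (ler_norm _)) // (le_trans (Re_le_normc _)) //.
    rewrite (le_trans (le_normcD _ _)) // -[leRHS]/(1 + 1 : R) lerD //.
    have -> : t%:C%C * (u / 2) * (t%:C%C * u) = (1 / 2)%:C%C * (t%:C%C * u) ^+ 2.
      have -> : (1 / 2 : R)%:C%C = 1 / 2 by rewrite rmorphM fmorphV rmorph_nat.
      ring.
    rewrite normcM normc_real normcX mulr_ile1 ?exprn_ge0 ?normc_ge0 ?exprn_ile1 ?normc_ge0 //.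
    rewrite ger0_norm; lra.
  by rewrite ler_piMl ?exprn_ge0 ?normc_ge0 // exprn_ile1.
move: (cmvt_bound fd fM).
rewrite /f /e /canon2 !mul1r !mul0r !addr0 cexp0 mulr1 [expR 2 * _ * 2]mulrAC.
by have -> : u ^+ 2 / 2 = u / 2 * u by ring.
Qed.

End ComplexBasics.

(** * Limits and infinite products of complex numbers *)

Section ComplexLimits.
Context {R : realType}.
Implicit Types (u v : nat -> R[i]) (l m : R[i]).

Definition ccvg u l :=
  (Re (u k) @[k --> \oo] --> Re l) /\ (Im (u k) @[k --> \oo] --> Im l).

Lemma ccvg_cst l : ccvg (fun=> l) l.
Proof. by split; exact: cvg_cst. Qed.

Lemma ccvgN u l : ccvg u l -> ccvg (fun k => - u k) (- l).
Proof.
move=> [h1 h2]; split.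
- rewrite ReN; under eq_fun do rewrite ReN; exact: cvgN.
- rewrite ImN; under eq_fun do rewrite ImN; exact: cvgN.
Qed.

Lemma ccvgD u v l m : ccvg u l -> ccvg v m -> ccvg (fun k => u k + v k) (l + m).
Proof.
move=> [h1 h2] [h3 h4]; split.
- rewrite ReD; under eq_fun do rewrite ReD; exact: cvgD.
- rewrite ImD; under eq_fun do rewrite ImD; exact: cvgD.
Qed.

Lemma ccvgM u v l m : ccvg u l -> ccvg v m -> ccvg (fun k => u k * v k) (l * m).
Proof.
move=> [h1 h2] [h3 h4]; split.
- rewrite ReM; under eq_fun do rewrite ReM; apply: cvgB; exact: cvgM.
- rewrite ImM; under eq_fun do rewrite ImM; apply: cvgD; exact: cvgM.
Qed.

Lemma ccvg_cexp u l : ccvg u l -> ccvg (fun k => cexp (u k)) (cexp l).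
Proof.
move=> [h1 h2].
have ReE z : Re (cexp z) = expR (Re z) * cos (Im z).
  by rewrite /cexp ReM /= mul0r subr0.
have ImE z : Im (cexp z) = expR (Re z) * sin (Im z).
  by rewrite /cexp ImM /= mul0r addr0.
have he : expR (Re (u k)) @[k --> \oo] --> expR (Re l).
  exact: continuous_cvg (@continuous_expR R _) h1.
have hc : cos (Im (u k)) @[k --> \oo] --> cos (Im l).
  exact: continuous_cvg (@continuous_cos R _) h2.
have hs : sin (Im (u k)) @[k --> \oo] --> sin (Im l).
  exact: continuous_cvg (@continuous_sin R _) h2.
split.
- rewrite ReE; under eq_fun do rewrite ReE; exact: cvgM.
- rewrite ImE; under eq_fun do rewrite ImE; exact: cvgM.
Qed.

Lemma ccvg_normc u l : ccvg u l -> normc (u k) @[k --> \oo] --> normc l.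
Proof.
move=> [h1 h2]; rewrite normcE; under eq_fun do rewrite normcE.
apply: (continuous_cvg _ (@sqrt_continuous R _)).
by apply: cvgD; apply: cvgM.
Qed.

Lemma ccvg_unique u l m : ccvg u l -> ccvg u m -> l = m.
Proof.
move=> [h1 h2] [h3 h4]; apply: complex_eq.
- exact: (cvg_unique _ h1 h3).
- exact: (cvg_unique _ h2 h4).
Qed.

Lemma ccvg_eventually u v l K :
  (forall k, (K <= k)%N -> u k = v k) -> ccvg u l -> ccvg v l.
Proof.
move=> uv [h1 h2]; split.
- apply: cvg_trans h1; apply: near_eq_cvg.
  by exists K => // k /= /uv ->.
- apply: cvg_trans h2; apply: near_eq_cvg.
  by exists K => // k /= /uv ->.
Qed.

Lemma ccvg_bound u l (e : nat -> R) K :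
  (forall k, (K <= k)%N -> normc (u k - l) <= e k) ->
  e k @[k --> \oo] --> 0 -> ccvg u l.
Proof.
move=> ue e0.
have key (f : R[i] -> R) : (forall z, `|f z| <= normc z) ->
    (forall z w, f (z - w) = f z - f w) -> f (u k) @[k --> \oo] --> f l.
  move=> fle fB; apply/cvgrPdist_lt => eps eps0.
  have [N _ hN] := cvgr0_norm_lt _ e0 _ eps0.
  exists (maxn K N) => // k /=; rewrite geq_max => /andP[Kk Nk].
  rewrite distrC -fB (le_lt_trans (fle _)) // (le_lt_trans (ue _ Kk)) //.
  by rewrite (le_lt_trans (ler_norm _)) // hN.
split; apply: key.
- exact: Re_le_normc.
- by move=> z w; rewrite ReD ReN.
- exact: Im_le_normc.
- by move=> z w; rewrite ImD ImN.
Qed.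

Lemma ccvg_lim (u : nat -> (R[i])^o) l : ccvg u l -> lim (u @ \oo) = l.
Proof.
move=> [h1 h2]; apply: (cvg_lim (@norm_hausdorff _ (R[i])^o)).
apply/cvgrPdist_lt => eps eps0.
have [e0 ee] : 0 < Re eps /\ eps = (Re eps)%:C%C.
  by move: eps0; rewrite ltcE /= => /andP[/eqP eI ?]; split=> //; apply: complex_eq.
have [N1 _ hN1] := (cvgrPdist_lt _ _).1 h1 _ (divr_gt0 e0 (@ltr0Sn R 1)).
have [N2 _ hN2] := (cvgrPdist_lt _ _).1 h2 _ (divr_gt0 e0 (@ltr0Sn R 1)).
exists (maxn N1 N2) => // k /=; rewrite geq_max => /andP[k1 k2].
rewrite [X in _ < X]ee normc_def ltcR -normcE.
rewrite (le_lt_trans (normc_le_ReIm _)) // ReD ImD ReN ImN.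
rewrite [X in _ < X](splitr (Re eps)) ltrD //; [exact: hN1|exact: hN2].
Qed.

Lemma cvg_cst_div (c : R) : c / k.+1%:R @[k --> \oo] --> 0.
Proof.
rewrite -[X in _ --> X](mulr0 c); apply: cvgM; first exact: cvg_cst.
exact: cvg_harmonic.
Qed.

(** The Cauchy criterion with an explicit rate, which is the form in which
    products with factors 1 + O(1/k^2) satisfy it. *)
Lemma cauchy_harmonic (x : nat -> R) (M : R) K :
  (forall j k, (K <= j <= k)%N -> `|x k - x j| <= M / j.+1%:R) ->
  exists a : R, x k @[k --> \oo] --> a.
Proof.
move=> h.
suff : cvg (x @ \oo) by move=> /cvg_ex.
apply: cauchy_cvg; apply: cauchy_exP => eps eps0.
have [N _ hN] := cvgr0_norm_lt _ (@cvg_cst_div M) _ eps0.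
set j := maxn K N; exists (x j); exists j => // k /= jk.
rewrite /ball /= distrC (le_lt_trans (h j k _)) ?jk ?leq_maxl //.
by rewrite (le_lt_trans (ler_norm _)) // hN //= leq_maxr.
Qed.

(** [near1 c z] says that z is as close to 1 as a finite product of factors
    1 + v with the sum of the |v| at most c; such bounds add up under
    multiplication. *)
Definition near1 (c : R) (z : R[i]) := normc (z - 1) <= expR c - 1.

Lemma near1_1 : near1 0 1.
Proof. by rewrite /near1 subrr normc0 expR0 subrr. Qed.

Lemma near1_le c d z : c <= d -> near1 c z -> near1 d z.
Proof. by rewrite /near1 => cd /le_trans -> //; rewrite lerB // ler_expR. Qed.

Lemma near1_small c z : normc (z - 1) <= c -> near1 c z.
Proof.
by move=> h; rewrite /near1 (le_trans h) // lerBrDl expR_ge1Dx.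
Qed.

Lemma near1_normc c z : near1 c z -> normc z <= expR c.
Proof.
rewrite /near1 => h; rewrite -[z](subrK 1) (le_trans (le_normcD _ _)) //.
by rewrite normc1 -lerBrDr.
Qed.

Lemma near1M c d z w : near1 c z -> near1 d w -> near1 (c + d) (z * w).
Proof.
move=> hz hw; have nz := near1_normc hz.
rewrite /near1 expRD.
have -> : z * w - 1 = z * (w - 1) + (z - 1) by ring.
rewrite (le_trans (le_normcD _ _)) // normcM.
have := ler_pM (normc_ge0 _) (normc_ge0 _) nz hw.
move: hz; rewrite /near1; lra.
Qed.

Lemma near1_prod n (F : 'I_n -> R[i]) c :
  (forall i, near1 c (F i)) -> near1 (n%:R * c) (\prod_i F i).
Proof.
elim: n F => [|n IH] F h; first by rewrite big_ord0 mul0r; exact: near1_1.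
rewrite big_ord_recl -natr1 addrC mulrDl mul1r; apply: near1M => //.
by apply: IH.
Qed.

Lemma expR_sub1_le (c : R) : expR c - 1 <= c * expR c.
Proof.
have := expR_ge1Dx (- c); rewrite expRN => h.
have e0 := expR_gt0 c.
have : (1 - c) * expR c <= 1 by rewrite -ler_pdivlMr // div1r.
lra.
Qed.

Lemma near1_harmonic (B : R) k z : 0 <= B -> near1 (B / k.+1%:R) z ->
  normc (z - 1) <= B * expR B / k.+1%:R.
Proof.
move=> B0 h; apply: (le_trans h); apply: (le_trans (expR_sub1_le _)).
rewrite mulrAC ler_pM2r ?invr_gt0 ?ltr0Sn // ler_wpM2l // ler_expR.
by rewrite ler_piMr // invf_le1 ?ltr0Sn // ler1n.
Qed.

Lemma ccvg_near1 (B : R) u K : 0 <= B ->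
  (forall k, (K <= k)%N -> near1 (B / k.+1%:R) (u k)) -> ccvg u 1.
Proof.
move=> B0 h; apply: (ccvg_bound (K := K)) (@cvg_cst_div (B * expR B)) => k Kk.
by apply: near1_harmonic => //; exact: h.
Qed.

(** An infinite product whose factors are 1 + O(1/k^2) converges, and its
    limit vanishes only if a partial product does. *)
Lemma infinite_product_cvg (P : nat -> R[i]) (B : R) K : 0 <= B ->
  (forall k, (K <= k)%N ->
     exists2 r, P k.+1 = P k * r & near1 (B / (k.+1%:R * k.+2%:R)) r) ->
  exists2 l, ccvg P l & (forall k, P k != 0) -> l != 0.
Proof.
move=> B0 step.
(* The bounds telescope: B / ((k+1)(k+2)) = B / (k+1) - B / (k+2). *)
have chain j k : (K <= j <= k)%N ->
    exists2 r, P k = P j * r & near1 (B / j.+1%:R - B / k.+1%:R) r.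
  elim: k => [|k IH] /andP[Kj].
    rewrite leqn0 => /eqP j0; move: Kj; rewrite j0 => _; exists 1.
      by rewrite mulr1.
    by rewrite subrr; exact: near1_1.
  rewrite leq_eqVlt => /predU1P[->|]; first by exists 1;
    rewrite ?mulr1 // subrr; exact: near1_1.
  rewrite ltnS => jk; have [|r1 Pr1 n1] := IH; first by rewrite Kj.
  have [|r2 Pr2 n2] := step k; first exact: leq_trans jk.
  exists (r1 * r2); first by rewrite Pr2 Pr1 mulrA.
  apply: near1_le (near1M n1 n2).
  rewrite le_eqVlt; apply/orP; left; apply/eqP.
  have h1 : k.+1%:R != 0 :> R by rewrite pnatr_eq0.
  have h2 : k.+2%:R != 0 :> R by rewrite pnatr_eq0.
  have e : k.+2%:R = k.+1%:R + 1 :> R by rewrite natr1.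
  have h3 : j.+1%:R != 0 :> R by rewrite pnatr_eq0.
  rewrite e in h2 *; move: h1 h2 h3.
  move: (k.+1%:R : R) (j.+1%:R : R) => x y h1 h2 h3; field.
  by rewrite h1 h2 h3.
have chain' j k : (K <= j <= k)%N ->
    normc (P k - P j) <= normc (P j) * (B * expR B / j.+1%:R).
  move=> /chain[r -> n].
  have -> : P j * r - P j = P j * (r - 1) by ring.
  rewrite normcM ler_wpM2l ?normc_ge0 //; apply: near1_harmonic => //.
  by apply: near1_le n; rewrite gerBl divr_ge0.
set D := B * expR B in chain'.
have D0 : 0 <= D by rewrite mulr_ge0 // expR_ge0.
pose M := normc (P K) * (1 + D).
have PM j : (K <= j)%N -> normc (P j) <= M.
  move=> Kj; have := chain' K j; rewrite leqnn Kj => /(_ isT) h.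
  rewrite -[P j](subrK (P K)) (le_trans (le_normcD _ _)) // /M mulrDr mulr1.
  rewrite addrC lerD2l (le_trans h) // ler_wpM2l ?normc_ge0 //.
  by rewrite ler_piMr // invf_le1 ?ltr0Sn // ler1n.
have cau j k : (K <= j <= k)%N -> normc (P k - P j) <= M * D / j.+1%:R.
  move=> jk; apply: (le_trans (chain' _ _ jk)).
  rewrite -mulrA ler_wpM2r ?divr_ge0 // PM //.
  by case/andP: jk.
have [a ha] : exists a : R, Re (P k) @[k --> \oo] --> a.
  apply: (@cauchy_harmonic _ (M * D) K) => j k jk.
  by rewrite -ReN -ReD (le_trans (Re_le_normc _)) // cau.
have [b hb] : exists a : R, Im (P k) @[k --> \oo] --> a.
  apply: (@cauchy_harmonic _ (M * D) K) => j k jk.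
  by rewrite -ImN -ImD (le_trans (Im_le_normc _)) // cau.
exists (a +i* b)%C; first by [].
move=> P0; have hP : ccvg P (a +i* b)%C by [].
have [N _ hN] := cvgr0_norm_lt _ (@cvg_cst_div D) _ (divr_gt0 (@ltr01 R) (@ltr0Sn R 1)).
set j := maxn K N.
have low k : (j <= k)%N -> normc (P j) / 2 <= normc (P k).
  move=> jk; have := chain' j k; rewrite leq_maxl jk => /(_ isT) h.
  have tri : normc (P j) <= normc (P k) + normc (P k - P j).
    by rewrite -[P j in leLHS](subKr (P k)) -(normcN (P k - P j)) le_normcD.
  have : D / j.+1%:R <= 1 / 2.
    by rewrite (le_trans (ler_norm _)) // ltW // hN //= leq_maxr.
  move=> /(ler_wpM2l (normc_ge0 (P j))) h2.
  have := le_trans tri (lerD (lexx _) (le_trans h h2)).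
  by rewrite mul1r -lerBlDr -[X in X - _]mulr1 -mulrBr (_ : 1 - 2^-1 = 2^-1 :> R); [|lra].
rewrite -normc_gt0; apply: (@lt_le_trans _ _ (normc (P j) / 2)).
  by rewrite divr_gt0 // normc_gt0.
have hn := ccvg_normc hP.
rewrite -(cvg_lim _ hn) //; apply: limr_ge; first by apply/cvg_ex; exists (normc (a +i* b)%C).
by exists j => // k /= /low.
Qed.

End ComplexLimits.

(** * Convergence of the sigma product *)

Section SymmetricBig.
Variables (T : Type) (idx : T) (op : Monoid.com_law idx).
Implicit Type f : int -> T.

(** An ordinal i below 2k + 1 stands for the integer i - k, as in the squares
    that exhaust the sigma product. *)
Definition symbig f (k : nat) :=
  \big[op/idx]_(i < k.*2.+1) f (i%:Z - k%:Z).

Lemma symbigS f k :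
  symbig f k.+1 = op (f (- k.+1%:Z)) (op (symbig f k) (f k.+1%:Z)).
Proof.
rewrite /symbig doubleS big_ord_recl big_ord_recr /= sub0r.
congr (op _ (op _ _)); last by congr f; rewrite /bump /=; lia.
by apply: eq_bigr => i _; congr f; rewrite /bump /=; lia.
Qed.

Lemma symbigN f k : symbig (fun m => f (- m)) k = symbig f k.
Proof.
rewrite /symbig (reindex_inj rev_ord_inj); apply: eq_bigr => i _.
by congr f; have := ltn_ord i; rewrite /= ; lia.
Qed.

Lemma symbig_shift f k :
  op (symbig (fun m => f (m - 1)) k) (f k) = op (f (- k%:Z - 1)) (symbig f k).
Proof.
rewrite /symbig big_ord_recl [in RHS]big_ord_recr /= -!Monoid.mulmA /=.
congr (op (f _) (op _ (f _))); [lia| |lia].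
by apply: eq_bigr => i _; congr f; rewrite /bump /=; lia.
Qed.

Lemma eq_symbig f g k : f =1 g -> symbig f k = symbig g k.
Proof. by move=> fg; apply: eq_bigr. Qed.

Lemma symbig_split f g k :
  symbig (fun m => op (f m) (g m)) k = op (symbig f k) (symbig g k).
Proof. by rewrite /symbig big_split. Qed.

(** Passing from one square to the next adds the two rows and the two columns
    of its boundary. *)
Lemma symbig2S (g : int -> int -> T) k :
  symbig (fun m => symbig (g m) k.+1) k.+1 =
  op (symbig (fun m => symbig (g m) k) k)
     (op (op (symbig (g (- k.+1%:Z)) k.+1) (symbig (g k.+1%:Z) k.+1))
         (op (symbig (g^~ (- k.+1%:Z)) k) (symbig (g^~ k.+1%:Z) k))).
Proof.
rewrite symbigS (eq_symbig k (fun m => symbigS (g m) k)) !symbig_split.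
by rewrite !Monoid.mulmA /= [LHS](AC 5 (3*1*5*2*4)).
Qed.

End SymmetricBig.
Arguments symbig {T idx} op f k.

Section Lattice.
Context {R : realType}.
Implicit Type L : lattice R.

Local Notation symprod := (symbig ( *%R : R[i] -> R[i] -> R[i])).
Local Notation symsum := (symbig ( +%R : R[i] -> R[i] -> R[i])).

Definition swap_lattice L : lattice R :=
  @Lattice R (gen2 L) (gen1 L)
    (fun s t h => let: conj a b :=
       gen_independent (etrans (addrC (t%:C%C * _) (s%:C%C * _)) h) in conj b a).

Definition gen_det L := Re (gen1 L) * Im (gen2 L) - Im (gen1 L) * Re (gen2 L).

Lemma gen_det_swap L : gen_det (swap_lattice L) = - gen_det L.
Proof. by rewrite /gen_det /=; ring. Qed.

Lemma gen_det_neq0 L : gen_det L != 0.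
Proof.
apply/eqP => D0.
have i1 := @gen_independent _ L (Im (gen2 L)) (- Im (gen1 L)).
have [|a1 a2] := i1.
  apply: complex_eq; rewrite ?ReD ?ImD ?ReM ?ImM /=; last by ring.
  by transitivity (gen_det L) => //; rewrite /gen_det; ring.
have i2 := @gen_independent _ L (Re (gen2 L)) (- Re (gen1 L)).
have [|b1 b2] := i2.
  apply: complex_eq; rewrite ?ReD ?ImD ?ReM ?ImM /=; first by ring.
  by transitivity (- gen_det L); [rewrite /gen_det; ring|rewrite D0 oppr0].
have i3 := @gen_independent _ L 1 0.
have [|/eqP] := i3; last by rewrite oner_eq0.
apply: complex_eq; rewrite ?ReD ?ImD ?ReM ?ImM /=; lra.
Qed.

Definition real_comb L (s t : R) := s%:C%C * gen1 L + t%:C%C * gen2 L.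

Lemma lattice_pointE L m n : lattice_point L m n = real_comb L m%:~R n%:~R.
Proof. by rewrite /lattice_point /real_comb !rmorph_int. Qed.

(** A constant d such that |s w1 + t w2| is at least d |s| and d |t|. *)
Definition lattice_gap L := `|gen_det L| / (normc (gen1 L) + normc (gen2 L)).

Lemma gen_norm_gt0 L : 0 < normc (gen1 L) + normc (gen2 L).
Proof.
rewrite lt0r addr_ge0 ?normc_ge0 // andbT; apply: contra (gen_det_neq0 L).
rewrite paddr_eq0 ?normc_ge0 // !normc_eq0 => /andP[/eqP e1 /eqP e2].
by rewrite /gen_det e1 e2 /= !mul0r subrr.
Qed.

Lemma lattice_gap_gt0 L : 0 < lattice_gap L.
Proof. by rewrite divr_gt0 ?gen_norm_gt0 // normr_gt0 gen_det_neq0. Qed.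

Lemma lattice_gap_swap L : lattice_gap (swap_lattice L) = lattice_gap L.
Proof. by rewrite /lattice_gap gen_det_swap normrN addrC. Qed.

(** Multiplying s w1 + t w2 by the conjugate of w2 and taking the imaginary part
    leaves s times the determinant, up to sign. *)
Lemma lattice_gap_le1 L s t : lattice_gap L * `|s| <= normc (real_comb L s t).
Proof.
rewrite mulrAC ler_pdivrMr ?gen_norm_gt0 // mulrC.
apply: (@le_trans _ _ (normc (real_comb L s t) * normc (gen2 L))); last first.
  by rewrite ler_wpM2l ?normc_ge0 // lerDr normc_ge0.
rewrite -[normc (gen2 L)](_ : normc (gen2 L)^*%C = _); last first.
  by rewrite !normcE; case: (gen2 L) => ? ? /=; rewrite sqrrN.
rewrite -normcM; apply: le_trans (Im_le_normc _).
rewrite -normrM -normrN le_eqVlt; apply/orP; left; apply/eqP; congr (`| _ |).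
rewrite /real_comb ImM ReD ImD !ReM !ImM /gen_det.
by case: (gen2 L) => ? ? /=; ring.
Qed.

Lemma real_comb_swap L s t : real_comb (swap_lattice L) t s = real_comb L s t.
Proof. by rewrite /real_comb addrC. Qed.

Lemma lattice_gap_le2 L s t : lattice_gap L * `|t| <= normc (real_comb L s t).
Proof. by rewrite -real_comb_swap -lattice_gap_swap lattice_gap_le1. Qed.

Lemma real_comb_inj L s t s' t' :
  real_comb L s t = real_comb L s' t' -> s = s' /\ t = t'.
Proof.
move=> e; have [] := @gen_independent _ L (s - s') (t - t').
  rewrite !rmorphB !mulrBl addrACA -opprD.
  by move: e; rewrite /real_comb => ->; rewrite subrr.
by move=> /eqP; rewrite subr_eq0 => /eqP -> /eqP; rewrite subr_eq0 => /eqP ->.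
Qed.

Lemma lattice_point_eq0 L m n :
  (lattice_point L m n == 0) = (m == 0) && (n == 0).
Proof.
apply/eqP/andP => [|[/eqP -> /eqP ->]]; last first.
  by rewrite /lattice_point !mul0r addr0.
have -> : (0 : R[i]) = real_comb L 0 0 by rewrite /real_comb !mul0r addr0.
by rewrite lattice_pointE => /real_comb_inj[/eqP + /eqP]; rewrite !intr_eq0.
Qed.

(** The factor at the origin is 1, because the field convention gives z / 0 = 0. *)
Lemma sigma_partialE L z k : sigma_partial L z k =
  z * symprod (fun m => symprod (fun n => canon2 (z / lattice_point L m n)) k) k.
Proof.
rewrite /sigma_partial /symbig; congr (_ * _); apply: eq_bigr => i _.
rewrite big_mkcond; apply: eq_bigr => j _ /=.
case: eqVneq => [->|w0] /=.
  by rewrite /canon2 invr0 mulr0 subr0 mul1r expr0n mul0r addr0 cexp0.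
by rewrite /canon2; congr (_ * cexp (_ + _)); field.
Qed.

Lemma sigma_partial_swap L : sigma_partial (swap_lattice L) = sigma_partial L.
Proof.
apply/funext => z; apply/funext => k; rewrite !sigma_partialE; congr (_ * _).
rewrite /symbig exchange_big; apply: eq_bigr => i _; apply: eq_bigr => j _.
by rewrite !lattice_pointE real_comb_swap.
Qed.

Lemma sigma_partialN L z k : sigma_partial L (- z) k = - sigma_partial L z k.
Proof.
rewrite !sigma_partialE mulNr; congr (- (_ * _)).
rewrite -symbigN; apply: eq_symbig => m.
rewrite -symbigN; apply: eq_symbig => n.
have -> : lattice_point L (- m) (- n) = - lattice_point L m n.
  by rewrite /lattice_point !mulrNz; ring.
by rewrite invrN mulrNN.
Qed.

Lemma near1_symprod (f : int -> R[i]) k c :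
  (forall m, near1 c (f m)) -> near1 (k.*2.+1%:R * c) (symprod f k).
Proof. by move=> h; exact: near1_prod. Qed.

Lemma canon2_lattice_near1 L z k m n :
  normc z <= lattice_gap L * k.+1%:R ->
  (k.+1%:R <= `|m%:~R : R|) || (k.+1%:R <= `|n%:~R : R|) ->
  near1 (expR 2 * 2 * (normc z / lattice_gap L) ^+ 3 / k.+1%:R ^+ 3)
    (canon2 (z / lattice_point L m n)).
Proof.
move=> zk mn; set w := lattice_point L m n.
have d0 := lattice_gap_gt0 L.
have wk : lattice_gap L * k.+1%:R <= normc w.
  rewrite /w lattice_pointE; case/orP: mn => h.
  - apply: le_trans (lattice_gap_le1 _ _ _); by rewrite ler_pM2l.
  - apply: le_trans (lattice_gap_le2 _ _ _); by rewrite ler_pM2l.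
have k0 : 0 < lattice_gap L * k.+1%:R by rewrite mulr_gt0.
have w0 : 0 < normc w by exact: lt_le_trans wk.
have u1 : normc (z / w) <= 1.
  by rewrite normcM normcV ler_pdivrMr // mul1r (le_trans zk).
have u2 : normc (z / w) <= normc z / lattice_gap L / k.+1%:R.
  rewrite normcM normcV -mulrA -invfM ler_wpM2l ?normc_ge0 //.
  by rewrite lef_pV2.
apply: near1_small; apply: (le_trans (canon2_near1 u1)).
rewrite -[leRHS]mulrA -expr_div_n ler_wpM2l ?mulr_ge0 ?expR_ge0 //.
have d1 := ltW d0.
rewrite lerXn2r // nnegrE ?normc_ge0 //.
exact: divr_ge0 (divr_ge0 (normc_ge0 _) d1) (ler0n _ _).
Qed.

Lemma large_index (a b : R) : 0 < b ->
  exists K, forall k, (K <= k)%N -> a <= b * k.+1%:R.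
Proof.
move=> b0; exists (Num.truncn (a / b)).+1 => k Kk.
rewrite mulrC -ler_pdivrMr // ltW // (lt_le_trans (truncnS_gt _)) //.
by rewrite ler_nat (leq_trans Kk).
Qed.

(** The boundary of the square of size k + 1 has 8 (k + 1) points, and each of
    them contributes a factor 1 + O(k^-3). *)
Lemma sigma_partial_cvg L z : exists2 l, ccvg (sigma_partial L z) l &
  ((forall k, sigma_partial L z k != 0) -> l != 0).
Proof.
have d0 := lattice_gap_gt0 L.
have [K hK] := large_index (normc z) d0.
set C := expR 2 * 2 * (normc z / lattice_gap L) ^+ 3.
have C0 : 0 <= C.
  have := divr_ge0 (normc_ge0 z) (ltW d0).
  by move=> /(exprn_ge0 3) ?; rewrite mulr_ge0 // mulr_ge0 // expR_ge0.
apply: (infinite_product_cvg (B := 16 * C) (K := K)); first by rewrite mulr_ge0.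
move=> k /hK zk; rewrite !sigma_partialE.
pose g m n := canon2 (z / lattice_point L m n).
set c := C / k.+1%:R ^+ 3.
have c0 : 0 <= c by rewrite divr_ge0.
have gn m n : (k.+1%:R <= `|m%:~R : R|) || (k.+1%:R <= `|n%:~R : R|) ->
   near1 c (g m n) by exact: canon2_lattice_near1.
have abs1 : k.+1%:R <= `|(k.+1%:Z)%:~R : R| by rewrite ger0_norm.
have abs2 : k.+1%:R <= `|(- k.+1%:Z)%:~R : R| by rewrite mulrNz normrN.
rewrite -/g symbig2S mulrA.
exists (symprod (g (- k.+1%:Z)) k.+1 * symprod (g k.+1%:Z) k.+1 *
  (symprod (g^~ (- k.+1%:Z)) k * symprod (g^~ k.+1%:Z) k)) => //.
have h1 : near1 (k.+1.*2.+1%:R * c) (symprod (g (- k.+1%:Z)) k.+1).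
  by apply: near1_symprod => n; apply: gn; rewrite abs2.
have h2 : near1 (k.+1.*2.+1%:R * c) (symprod (g k.+1%:Z) k.+1).
  by apply: near1_symprod => n; apply: gn; rewrite abs1.
have h3 : near1 (k.*2.+1%:R * c) (symprod (g^~ (- k.+1%:Z)) k).
  by apply: near1_symprod => n; apply: gn; rewrite abs2 orbT.
have h4 : near1 (k.*2.+1%:R * c) (symprod (g^~ k.+1%:Z) k).
  by apply: near1_symprod => n; apply: gn; rewrite abs1 orbT.
apply: near1_le (near1M (near1M h1 h2) (near1M h3 h4)).
have -> : k.+1.*2.+1%:R * c + k.+1.*2.+1%:R * c + (k.*2.+1%:R * c + k.*2.+1%:R * c)
   = 8 * C / k.+1%:R ^+ 2.
  have -> : k.+1.*2.+1%:R = 2 * k.+1%:R + 1 :> R by rewrite -muln2 -natr1 natrM mulrC.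
  have -> : k.*2.+1%:R = 2 * k.+1%:R - 1 :> R.
    by rewrite -muln2 -(natr1 k) -natr1 natrM; ring.
  rewrite /c; have : k.+1%:R != 0 :> R by rewrite pnatr_eq0.
  move: (k.+1%:R : R) => x x0; field; exact: x0.
have k1 : 0 < k.+1%:R :> R by [].
have -> : k.+2%:R = k.+1%:R + 1 :> R by rewrite natr1.
have : 1 <= k.+1%:R :> R by rewrite ler1n.
move: (k.+1%:R : R) k1 => x x0 x1.
have xx : 0 < x + 1 by rewrite addr_gt0.
rewrite -subr_ge0 (_ : _ - _ = 8 * C * (x - 1) / (x ^+ 2 * (x + 1))).
  have x1' : 0 <= x - 1 by rewrite subr_ge0.
  apply: divr_ge0; first exact: mulr_ge0 (mulr_ge0 (ler0n _ 8) C0) x1'.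
  exact: mulr_ge0 (exprn_ge0 2 (ltW x0)) (ltW xx).
by field; rewrite !gt_eqF.
Qed.

Lemma sigma_cvg L z : ccvg (sigma_partial L z) (weierstrass_sigma L z).
Proof. by have [l h _] := sigma_partial_cvg L z; rewrite /weierstrass_sigma (ccvg_lim h). Qed.

Lemma sigma_partial_neq0 L z k : ~ lattice_set L z -> sigma_partial L z k != 0.
Proof.
move=> zL; rewrite sigma_partialE mulf_neq0 //.
  by apply/eqP => z0; apply: zL; exists 0, 0; rewrite z0 /lattice_point !mul0r addr0.
apply/prodf_neq0 => i _; apply/prodf_neq0 => j _.
rewrite /canon2 mulf_neq0 ?cexp_neq0 // subr_eq0; apply/eqP => e.
apply: zL; exists (i%:Z - k%:Z), (j%:Z - k%:Z); move: e.
set w := lattice_point _ _ _; have [->|w0] := eqVneq w 0.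
  by rewrite invr0 mulr0 => /eqP; rewrite oner_eq0.
by move=> /(congr1 ( *%R^~ w)); rewrite mul1r divfK.
Qed.

Lemma sigma_neq0 L z : ~ lattice_set L z -> weierstrass_sigma L z != 0.
Proof.
move=> zL; have [l h] := sigma_partial_cvg L z.
rewrite -(ccvg_unique (sigma_cvg L z) h); apply => k.
exact: sigma_partial_neq0.
Qed.

Lemma sigmaN L z : weierstrass_sigma L (- z) = - weierstrass_sigma L z.
Proof.
apply: ccvg_unique (sigma_cvg L (- z)) _.
have -> : sigma_partial L (- z) = (fun k => - sigma_partial L z k).
  by apply/funext => k; rewrite sigma_partialN.
exact: ccvgN (sigma_cvg L z).
Qed.

Lemma weierstrass_sigma_swap L :
  weierstrass_sigma (swap_lattice L) = weierstrass_sigma L.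
Proof. by apply/funext => z; rewrite /weierstrass_sigma sigma_partial_swap. Qed.

End Lattice.

(** * The sigma product under a shift by a generator *)

Section Shift.
Context {R : realType}.
Implicit Type L : lattice R.

Local Notation symprod := (symbig ( *%R : R[i] -> R[i] -> R[i])).
Local Notation symsum := (symbig ( +%R : R[i] -> R[i] -> R[i])).

Lemma symprod_cexp (f : int -> R[i]) k :
  symprod (fun m => cexp (f m)) k = cexp (symsum f k).
Proof. by rewrite /symbig cexp_sum. Qed.

Lemma symsumZ a (f : int -> R[i]) k :
  symsum (fun m => a * f m) k = a * symsum f k.
Proof. by rewrite /symbig mulr_sumr. Qed.

Lemma symprodN (f : int -> R[i]) k :
  symprod (fun m => - f m) k = - symprod f k.
Proof.
rewrite /symbig; under eq_bigr do rewrite -mulN1r.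
rewrite big_split /= prodr_const card_ord -signr_odd /= odd_double.
by rewrite expr1 mulN1r.
Qed.

Lemma lattice_pointN L m n : lattice_point L (- m) (- n) = - lattice_point L m n.
Proof. by rewrite /lattice_point !mulrNz; ring. Qed.

(** A square is symmetric about the origin. *)
Lemma symsum_lattice_inv L k :
  symsum (fun m => symsum (fun n => (lattice_point L m n)^-1) k) k = 0.
Proof.
set T := LHS; suff /eqP : T = - T by rewrite -addr_eq0 -mulr2n mulrn_eq0 => /eqP.
rewrite -[RHS]mulN1r /T -symsumZ -symbigN; apply: eq_symbig => m.
rewrite -symsumZ -symbigN; apply: eq_symbig => n.
by rewrite lattice_pointN invrN mulN1r.
Qed.

Definition square_inv2 L k :=
  symsum (fun m => symsum (fun n => (lattice_point L m n) ^- 2) k) k.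

Definition square_roots L z k :=
  symprod (fun m => symprod (fun n => z - lattice_point L m n) k) k.

(** The constant that turns the monic product of the z - w into the product of
    the 1 - z / w and the leading factor z. *)
Definition square_norm L k : R[i] :=
  symprod (fun m => symprod (fun n =>
    if lattice_point L m n == 0 then 1 else - (lattice_point L m n)^-1) k) k.

Lemma symprod_origin L z k :
  symprod (fun m => symprod (fun n =>
    if lattice_point L m n == 0 then z else 1) k) k = z.
Proof.
have kk : (k < k.*2.+1)%N by lia.
have E (i : 'I_k.*2.+1) : (i%:Z - k%:Z == 0) = (i == Ordinal kk).
  by rewrite -val_eqE /=; lia.
rewrite /symbig (bigD1 (Ordinal kk)) //= [X in _ * X]big1 => [|i ik].
  rewrite mulr1 (bigD1 (Ordinal kk)) //= [X in _ * X]big1 => [|j jk].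
    by rewrite mulr1 lattice_point_eq0 !subrr.
  by rewrite lattice_point_eq0 E (negbTE jk) andbF.
by rewrite big1 // => j _; rewrite lattice_point_eq0 E (negbTE ik).
Qed.

(** The exponentials of z / w cancel in pairs, so a partial product is a
    polynomial times the exponential of a quadratic monomial. *)
Lemma sigma_partial_roots L z k : sigma_partial L z k =
  square_roots L z k * square_norm L k * cexp (z ^+ 2 * square_inv2 L k / 2).
Proof.
pose w := lattice_point L.
have -> : square_roots L z k * square_norm L k =
    z * symprod (fun m => symprod (fun n => 1 - z / w m n) k) k.
  rewrite -[X in _ = X * _](symprod_origin L z k) /square_roots /square_norm.
  rewrite -!symbig_split; apply: eq_symbig => m.
  rewrite -!symbig_split; apply: eq_symbig => n.
  rewrite -/(w m n); case: eqVneq => [->|w0].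
    by rewrite /= subr0 invr0 mulr0 subr0 !mulr1.
  by rewrite /=; field.
rewrite sigma_partialE -[RHS]mulrA; congr (_ * _).
pose T := symsum (fun m => symsum (fun n => z * (w m n)^-1) k) k.
have T0 : T = 0.
  rewrite /T; under [X in symbig _ X _]eq_fun do rewrite symsumZ.
  by rewrite symsumZ symsum_lattice_inv mulr0.
have -> : z ^+ 2 * square_inv2 L k / 2 = T +
    symsum (fun m => symsum (fun n => (z ^+ 2 / 2) * (w m n) ^- 2) k) k.
  under [X in _ + symbig _ X _]eq_fun do rewrite symsumZ.
  by rewrite symsumZ T0 add0r mulrAC.
rewrite cexpD -!symprod_cexp.
under [X in _ * (symbig _ X _ * _)]eq_fun do rewrite -symprod_cexp.
under [X in _ * (_ * symbig _ X _)]eq_fun do rewrite -symprod_cexp.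
rewrite -!symbig_split; apply: eq_symbig => m.
rewrite -!symbig_split; apply: eq_symbig => n.
rewrite /canon2 /= -/(w m n) -cexpD; congr (_ * cexp (_ + _)).
by rewrite expr_div_n mulrAC.
Qed.

(** The midpoints between row k and row k + 1: a shift by the first generator
    moves one edge of the square of zeros across them. *)
Definition half_edge L k (n : int) := real_comb L (k%:R + 2^-1) n%:~R.

Definition edge_sum L k := symsum (fun n => (half_edge L k n)^-1) k.

(** Half the quasi-period of sigma_k that belongs to the first generator. *)
Definition quasi_coef L k := edge_sum L k + gen1 L * square_inv2 L k / 2.

Lemma half_edge_norm L k n :
  lattice_gap L * k.+1%:R <= 2 * normc (half_edge L k n).
Proof.
have := lattice_gap_le1 L (k%:R + 2^-1) n%:~R.
rewrite -/(half_edge L k n) ger0_norm; last by rewrite addr_ge0 // invr_ge0.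
have := lattice_gap_gt0 L; have : 0 <= k%:R :> R by [].
rewrite -(natr1 k); move: (k%:R : R) (lattice_gap L) => x d x0 d0 h.
by have := mulr_ge0 (ltW d0) x0; lra.
Qed.

Lemma half_edge_neq0 L k n : half_edge L k n != 0.
Proof.
rewrite -normc_gt0 -(@pmulr_rgt0 _ 2) //.
by rewrite (lt_le_trans _ (half_edge_norm _ _ _)) // mulr_gt0 // lattice_gap_gt0.
Qed.

Lemma symprod_edge L z k : symprod (fun n => z - lattice_point L k%:Z n) k =
  - symprod (fun n => half_edge L k n *
       (1 - (2 * z + gen1 L) / (2 * half_edge L k n))) k.
Proof.
rewrite -symprodN; apply: eq_symbig => n; rewrite mulrBr mulr1.
have -> : half_edge L k n * ((2 * z + gen1 L) / (2 * half_edge L k n)) =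
  (2 * z + gen1 L) / 2 by (field; exact: half_edge_neq0).
rewrite lattice_pointE /half_edge /real_comb rmorphD fmorphV !rmorph_nat /=.
by rewrite rmorph_int; field.
Qed.

Lemma symprod_edge' L z k :
  symprod (fun n => z - lattice_point L (- k%:Z - 1) n) k =
  symprod (fun n => half_edge L k n *
       (1 + (2 * z + gen1 L) / (2 * half_edge L k n))) k.
Proof.
rewrite -symbigN; apply: eq_symbig => n; rewrite mulrDr mulr1.
have -> : half_edge L k n * ((2 * z + gen1 L) / (2 * half_edge L k n)) =
  (2 * z + gen1 L) / 2 by (field; exact: half_edge_neq0).
rewrite -opprD lattice_pointN lattice_pointE /half_edge /real_comb.
rewrite intrD !rmorphD fmorphV !rmorph_nat !rmorph1 !rmorph_int /=.
by field.
Qed.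

Lemma square_roots_shift L z k :
  square_roots L (z + gen1 L) k *
    symprod (fun n => 1 - (2 * z + gen1 L) / (2 * half_edge L k n)) k =
  - (square_roots L z k *
     symprod (fun n => 1 + (2 * z + gen1 L) / (2 * half_edge L k n)) k).
Proof.
have := symbig_shift *%R
  (fun m => symprod (fun n => z - lattice_point L m n) k) k.
rewrite symprod_edge symprod_edge' /=.
have -> : symprod (fun m => symprod (fun n => z - lattice_point L (m - 1) n) k) k
    = square_roots L (z + gen1 L) k.
  apply: eq_symbig => m; apply: eq_symbig => n.
  by rewrite /lattice_point rmorphB rmorph1; ring.
rewrite -/(square_roots L z k) !symbig_split /=.
have H0 : symprod (fun n => half_edge L k n) k != 0.
  by apply/prodf_neq0 => i _; exact: half_edge_neq0.
move: (symprod (fun n => half_edge L k n) k) H0 => H H0 E.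
move: (square_roots L (z + gen1 L) k) (square_roots L z k) E => A B.
move: (symprod _ k) (symprod _ k) => b a E.
apply: (mulfI H0); transitivity (- (A * - (H * a))); first by ring.
by rewrite E; ring.
Qed.

(** Shifting the square of zeros by a period changes only one edge on each
    side; pairing the two edges point by point leaves the factors
    (1 + u) / (1 - u), and (1 + u) / (1 - u) = e^(2u) (1 + O(u^2)). *)
Lemma sigma_partial_shift L z k (u := fun n => (2 * z + gen1 L) / (2 * half_edge L k n)) :
  sigma_partial L (z + gen1 L) k * symprod (fun n => canon1 (u n)) k =
  - (sigma_partial L z k * symprod (fun n => canon1 (- u n)) k *
     cexp ((2 * z + gen1 L) * quasi_coef L k)).
Proof.
set y := 2 * z + gen1 L.
have S := square_roots_shift L z k.
have c1 : symprod (fun n => canon1 (u n)) k =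
    symprod (fun n => 1 - u n) k * cexp (y * edge_sum L k / 2).
  have -> : y * edge_sum L k / 2 = symsum u k.
    rewrite mulrAC -symsumZ; apply: eq_symbig => n.
    by rewrite /u -/y; field; rewrite half_edge_neq0.
  by rewrite -symprod_cexp -symbig_split.
have c2 : symprod (fun n => canon1 (- u n)) k =
    symprod (fun n => 1 + u n) k * cexp (- (y * edge_sum L k / 2)).
  have -> : - (y * edge_sum L k / 2) = symsum (fun n => - u n) k.
    rewrite -mulN1r mulrAC mulrA -symsumZ; apply: eq_symbig => n.
    by rewrite /u -/y; field; rewrite half_edge_neq0.
  rewrite -symprod_cexp -symbig_split; apply: eq_symbig => n.
  by rewrite /canon1 opprK.
rewrite !sigma_partial_roots c1 c2.
set a := cexp (_ / 2) in c1 *; set b := cexp (- _).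
have -> : (z + gen1 L) ^+ 2 * square_inv2 L k / 2 =
    z ^+ 2 * square_inv2 L k / 2 + y * (gen1 L * square_inv2 L k / 2).
  by rewrite /y; ring.
have -> : y * quasi_coef L k = y * edge_sum L k / 2 + y * edge_sum L k / 2 +
    y * (gen1 L * square_inv2 L k / 2) by rewrite /quasi_coef; field.
have ba : b * cexp (y * edge_sum L k / 2) = 1 by rewrite /b cexpNK.
rewrite !cexpD.
move: S ba; rewrite -/y -/u.
move: (square_roots L (z + gen1 L) k) (square_roots L z k) => A B.
move: (symprod (fun n => 1 - u n) k) (symprod (fun n => 1 + u n) k) => p q.
rewrite -/a => S ba; set c := cexp (y * (gen1 L * _ / 2)).
transitivity (A * p * (square_norm L k * cexp (z ^+ 2 * square_inv2 L k / 2) * c * a)).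
  by ring.
by rewrite S; transitivity (- (B * q) * (square_norm L k *
  cexp (z ^+ 2 * square_inv2 L k / 2) * c * a) * (b * a)); [rewrite ba mulr1|ring].
Qed.

End Shift.

(** * Quasi-periodicity of sigma *)

Section Quasiperiod.
Context {R : realType}.
Implicit Type L : lattice R.

Local Notation symprod := (symbig ( *%R : R[i] -> R[i] -> R[i])).
Local Notation symsum := (symbig ( +%R : R[i] -> R[i] -> R[i])).

Lemma canon1_edge_cvg L y : ccvg
  (fun k => symprod (fun n => canon1 (y / (2 * half_edge L k n))) k) 1.
Proof.
have d0 := lattice_gap_gt0 L.
have [K hK] := large_index (normc y) d0.
set C := normc y / lattice_gap L.
have C0 : 0 <= C by exact: divr_ge0 (normc_ge0 _) (ltW d0).
pose B : R := 2 * (expR 1 * 2 * C ^+ 2).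
have E0 : 0 <= expR 1 * 2 * C ^+ 2.
  exact: mulr_ge0 (mulr_ge0 (expR_ge0 1) (ler0n _ 2)) (exprn_ge0 2 C0).
have B0 : 0 <= B by exact: mulr_ge0 (ler0n _ 2) E0.
apply: (ccvg_near1 (B := B) (K := K)) => // k /hK yk.
apply: (near1_le (c := k.*2.+1%:R * (expR 1 * 2 * C ^+ 2 / k.+1%:R ^+ 2))).
  have k2 : k.*2.+1%:R <= 2 * k.+1%:R :> R by rewrite -natrM ler_nat; lia.
  have -> : B / k.+1%:R = 2 * k.+1%:R * (expR 1 * 2 * C ^+ 2 / k.+1%:R ^+ 2).
    rewrite /B; have : k.+1%:R != 0 :> R by rewrite pnatr_eq0.
    by move: (k.+1%:R : R) => x x0; field; exact: x0.
  by apply: ler_wpM2r k2; apply: divr_ge0 E0 _; exact: exprn_ge0.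
apply: near1_symprod => n; apply: near1_small.
have q0 := half_edge_norm L k n.
have q1 : 0 < lattice_gap L * k.+1%:R by rewrite mulr_gt0.
have q2 := lt_le_trans q1 q0.
have un : normc (y / (2 * half_edge L k n)) <= C / k.+1%:R.
  rewrite normcM normcV normcM.
  have -> : normc (2 : R[i]) = 2 
    by rewrite -[2 in LHS](rmorph_nat (real_complex R)) normc_real ger0_norm.
  by rewrite /C -mulrA -invfM ler_wpM2l ?normc_ge0 // lef_pV2.
have C1 : C / k.+1%:R <= 1.
  by rewrite ler_pdivrMr // mul1r ler_pdivrMr // mulrC.
apply: (le_trans (canon1_near1 (le_trans un C1))).
rewrite -[leRHS]mulrA -expr_div_n ler_wpM2l ?mulr_ge0 ?expR_ge0 //.
rewrite lerXn2r // nnegrE ?normc_ge0 //.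
exact: divr_ge0 C0 (ler0n _ _).
Qed.

Lemma canon1_edge_cvgN L y : ccvg
  (fun k => symprod (fun n => canon1 (- (y / (2 * half_edge L k n)))) k) 1.
Proof.
have := canon1_edge_cvg L (- y).
by under eq_fun do under eq_symbig do rewrite mulNr.
Qed.

Lemma ln_normc_ratio (p a q b w : R[i]) : p * a = - (q * b * cexp w) ->
  0 < normc q * normc b -> ln (normc p * normc a / (normc q * normc b)) = Re w.
Proof.
move=> e qb; rewrite -normcM e normcN normcM normcM normc_cexp.
by rewrite mulrC mulKf ?expRK // gt_eqF.
Qed.

(** The sum of the w^-2 over the lattice is only conditionally convergent; the
    coefficient converges because the quotient of sigma at z + w1 and at z,
    which it governs, has a nonzero limit. *)
Lemma quasi_coef_Re_cvg L z :
  ~ lattice_set L z -> ~ lattice_set L (z + gen1 L) ->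
  exists a : R, Re ((2 * z + gen1 L) * quasi_coef L k) @[k --> \oo] --> a.
Proof.
move=> h1 h2; set y := 2 * z + gen1 L.
pose A k := symprod (fun n => canon1 (y / (2 * half_edge L k n))) k.
pose A' k := symprod (fun n => canon1 (- (y / (2 * half_edge L k n)))) k.
have cA : ccvg A 1 by exact: canon1_edge_cvg.
have cA' : ccvg A' 1 by exact: canon1_edge_cvgN.
pose p k := normc (sigma_partial L (z + gen1 L) k) * normc (A k).
pose q k := normc (sigma_partial L z k) * normc (A' k).
have s1 : 0 < normc (weierstrass_sigma L (z + gen1 L)) by rewrite normc_gt0 sigma_neq0.
have s2 : 0 < normc (weierstrass_sigma L z) by rewrite normc_gt0 sigma_neq0.
have cp : p k @[k --> \oo] --> normc (weierstrass_sigma L (z + gen1 L)) * normc (1 : R[i]).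
  by apply: cvgM; apply: ccvg_normc => //; exact: sigma_cvg.
have cq : q k @[k --> \oo] --> normc (weierstrass_sigma L z) * normc (1 : R[i]).
  by apply: cvgM; apply: ccvg_normc => //; exact: sigma_cvg.
rewrite normc1 !mulr1 in cp cq.
set s1v := normc _ in cp s1; set s2v := normc _ in cq s2.
exists (ln (s1v / s2v)).
have : ln (p k / q k) @[k --> \oo] --> ln (s1v / s2v).
  apply: continuous_cvg; first by apply: continuous_ln; rewrite divr_gt0.
  by apply: cvgM => //; apply: cvgV => //; rewrite gt_eqF.
apply: cvg_trans; apply: near_eq_cvg.
have [N _ hN] := cvgr_gt _ cq _ s2.
exists N => // k /hN /= qk.
exact: ln_normc_ratio (sigma_partial_shift L z k) qk.
Qed.

Lemma notin_lattice L (s t : R) :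
  ~ (exists m n : int, s = m%:~R /\ t = n%:~R) -> ~ lattice_set L (real_comb L s t).
Proof.
move=> h [m [n]]; rewrite lattice_pointE => /real_comb_inj[? ?].
by apply: h; exists m, n.
Qed.

Lemma half_notint (m : int) : (2^-1 : R) <> m%:~R.
Proof.
move=> e; have : (2%:Z * m)%:~R = 1%:~R :> R by rewrite intrM -e; apply: mulfV; rewrite pnatr_eq0.
by move/eqP; rewrite eqr_int => /eqP; lia.
Qed.

Lemma quarter_notint (j : nat) (m : int) : odd j -> (j%:R / 4 : R) <> m%:~R.
Proof.
move=> jo e; have : (4%:Z * m)%:~R = (j%:Z)%:~R :> R.
  by rewrite intrM -e mulrC; apply: divfK; rewrite pnatr_eq0.
by move/eqP; rewrite eqr_int => /eqP; lia.
Qed.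

(** The real parts of w1 c_k / 2 and of w2 c_k converge, by the choices
    z = -w1 / 4 and z = (w2 - w1) / 2; as w1 and w2 are independent over the
    reals, so does c_k. *)
Lemma quasi_coef_cvg L : exists c, ccvg (quasi_coef L) c.
Proof.
have [||a1 h1] := @quasi_coef_Re_cvg L (real_comb L (- (1 / 4)) 0).
- apply: notin_lattice => -[m [_ [e _]]]; apply: (@quarter_notint 1 (- m)) => //.
  by rewrite mulrNz -e opprK.
- have -> : real_comb L (- (1 / 4)) 0 + gen1 L = real_comb L (3%:R / 4) 0.
    rewrite /real_comb !mul0r !addr0 -[X in _ + X]mul1r -mulrDl -(rmorph1 (real_complex R)).
    by rewrite -rmorphD; congr (_%:C%C * _); field.
  by apply: notin_lattice => -[m [_ [e _]]]; apply: (@quarter_notint 3 m).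
have [||a2 h2] := @quasi_coef_Re_cvg L (real_comb L (- 2^-1) 2^-1).
- apply: notin_lattice => -[_ [n [_ e]]]; exact: half_notint e.
- have -> : real_comb L (- 2^-1) 2^-1 + gen1 L = real_comb L 2^-1 2^-1.
    rewrite /real_comb addrAC -[X in _ + X + _]mul1r -mulrDl -(rmorph1 (real_complex R)).
    by rewrite -rmorphD; congr (_%:C%C * _ + _); field.
  by apply: notin_lattice => -[_ [n [_ e]]]; exact: half_notint e.
have e1 : 2 * real_comb L (- (1 / 4)) 0 + gen1 L = gen1 L / 2.
  by rewrite /real_comb rmorphN fmorph_div rmorph1 !rmorph_nat; field.
have e2 : 2 * real_comb L (- 2^-1) 2^-1 + gen1 L = gen2 L.
  by rewrite /real_comb rmorphN !fmorphV !rmorph_nat; field.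
rewrite e1 in h1; rewrite e2 in h2.
have D0 := gen_det_neq0 L.
pose c k := quasi_coef L k.
have eR k : Re (c k) =
    (2 * Im (gen2 L) * Re (gen1 L / 2 * c k) - Im (gen1 L) * Re (gen2 L * c k)) / gen_det L.
  have -> : gen1 L / 2 * c k = 2^-1%:C%C * (gen1 L * c k).
    by rewrite fmorphV rmorph_nat; ring.
  rewrite !ReM /= !ImM; move: D0; rewrite /gen_det => D0; field; exact: D0.
have eI k : Im (c k) =
    (2 * Re (gen2 L) * Re (gen1 L / 2 * c k) - Re (gen1 L) * Re (gen2 L * c k)) / gen_det L.
  have -> : gen1 L / 2 * c k = 2^-1%:C%C * (gen1 L * c k).
    by rewrite fmorphV rmorph_nat; ring.
  rewrite !ReM /= !ImM; move: D0; rewrite /gen_det => D0; field; exact: D0.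
exists (((2 * Im (gen2 L) * a1 - Im (gen1 L) * a2) / gen_det L) +i*
        ((2 * Re (gen2 L) * a1 - Re (gen1 L) * a2) / gen_det L))%C.
split => /=.
- under eq_fun do rewrite -/(c _) eR.
  apply: cvgM; last exact: cvg_cst.
  by apply: cvgB; apply: cvgM => //; exact: cvg_cst.
- under eq_fun do rewrite -/(c _) eI.
  apply: cvgM; last exact: cvg_cst.
  by apply: cvgB; apply: cvgM => //; exact: cvg_cst.
Qed.

Lemma sigma_quasiperiodic L c z : ccvg (quasi_coef L) c ->
  weierstrass_sigma L (z + gen1 L) =
  - (weierstrass_sigma L z * cexp ((2 * z + gen1 L) * c)).
Proof.
move=> hc; set y := 2 * z + gen1 L.
have h1 := ccvgM (sigma_cvg L (z + gen1 L)) (canon1_edge_cvg L y).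
have h2 := ccvgM (ccvgM (sigma_cvg L z) (canon1_edge_cvgN L y))
                 (ccvg_cexp (ccvgM (ccvg_cst y) hc)).
rewrite !mulr1 in h1 h2; apply: ccvg_unique h1 _.
apply: (ccvg_eventually (K := 0)) (ccvgN h2) => k _.
by rewrite -sigma_partial_shift.
Qed.

End Quasiperiod.

(** * Legendre's relation and the modified sigma function *)

Section Legendre.
Context {R : realType}.
Implicit Type L : lattice R.

Local Notation symsum := (symbig ( +%R : R[i] -> R[i] -> R[i])).

(** One step of a left Riemann sum for the integral of 1 / (1 + x^2). *)
Lemma atan_step (x h : R) : 0 <= h ->
  h / (1 + x ^+ 2) <= atan (x + h) - atan x + h ^+ 2.
Proof.
move=> h0.
have xh : x <= x + h by rewrite lerDl.
have ca : {within `[x, x + h], continuous (@atan R)}.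
  by apply: continuous_subspaceT => t; exact: continuous_atan.
have [c] := MVT_segment xh (fun t _ => is_derive1_atan t) ca.
rewrite in_itv /= => /andP[xc ch] ->.
rewrite addrAC subrr add0r.
have p1 : 0 < 1 + x ^+ 2 by rewrite ltr_pwDl // sqr_ge0.
have p2 : 0 < 1 + c ^+ 2 by rewrite ltr_pwDl // sqr_ge0.
rewrite -subr_ge0.
have -> : (1 + c ^+ 2)^-1 * h + h ^+ 2 - h / (1 + x ^+ 2) =
  h * (h * ((1 + x ^+ 2) * (1 + c ^+ 2)) - (c - x) * (c + x)) /
  ((1 + x ^+ 2) * (1 + c ^+ 2)).
  by field; rewrite !gt_eqF.
apply: divr_ge0; last by rewrite mulr_ge0 // ltW.
apply: mulr_ge0 => //.
have cx : c + x <= (1 + x ^+ 2) * (1 + c ^+ 2).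
  have := sqr_ge0 (c - 1); have := sqr_ge0 (x - 1).
  have := mulr_ge0 (sqr_ge0 x) (sqr_ge0 c); nra.
have ncx : - (c + x) <= (1 + x ^+ 2) * (1 + c ^+ 2).
  have := sqr_ge0 (c + 1); have := sqr_ge0 (x + 1).
  have := mulr_ge0 (sqr_ge0 x) (sqr_ge0 c); nra.
have cxh : c - x <= h by lra.
have cx0 : 0 <= c - x by rewrite subr_ge0.
rewrite subr_ge0; move: cx; move: (_ * (1 + c ^+ 2)) ncx => M n1 n2.
apply: (@le_trans _ _ ((c - x) * M)); first by rewrite ler_wpM2l.
by rewrite ler_wpM2r //; lra.
Qed.

(** The summands integrate to a difference of arctangents, which is less than
    pi. *)
Lemma poisson_sum_le (a b : R) n : 0 < b ->
  \sum_(i < n) b / ((i%:R + a) ^+ 2 + b ^+ 2) <= pi + n%:R / b ^+ 2.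
Proof.
move=> b0.
pose g (i : nat) := atan ((i%:R + a) / b).
apply: (@le_trans _ _ (\sum_(i < n) (g i.+1 - g i + b^-1 ^+ 2))).
  apply: ler_sum => i _.
  have := atan_step ((i%:R + a) / b) (ltW (_ : 0 < b^-1)).
  rewrite invr_gt0 => /(_ b0).
  have -> : (i%:R + a) / b + b^-1 = (i.+1%:R + a) / b by rewrite -natr1; ring.
  apply: le_trans; rewrite le_eqVlt; apply/orP; left; apply/eqP.
  have : (i%:R + a) ^+ 2 + b ^+ 2 != 0 by rewrite gt_eqF // ltr_wpDl ?sqr_ge0 ?exprn_gt0.
  move: (i%:R + a) => t t0; field; rewrite (gt_eqF b0) /=.
  by rewrite addrC t0.
rewrite big_split /= -(big_mkord xpredT (fun i => g i.+1 - g i)) telescope_sumr //.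
rewrite sumr_const card_ord -[X in _ + X]mulr_natl exprVn lerD2r.
by have := atan_ltpi2 ((n%:R + a) / b); have := atan_gtNpi2 ((0%:R + a) / b); rewrite /g; lra.
Qed.

Lemma square_inv2_swap L k : square_inv2 (swap_lattice L) k = square_inv2 L k.
Proof.
rewrite /square_inv2 /symbig exchange_big; apply: eq_bigr => i _.
by apply: eq_bigr => j _; rewrite !lattice_pointE real_comb_swap.
Qed.

Lemma Im_sum I (r : seq I) (F : I -> R[i]) :
  Im (\sum_(i <- r) F i) = \sum_(i <- r) Im (F i).
Proof. by elim/big_rec2: _ => [|i x y _ <-] //; rewrite ImD. Qed.

Lemma Im_symsum (f : int -> R[i]) k :
  Im (symsum f k) = \sum_(i < k.*2.+1) Im (f (i%:Z - k%:Z)).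
Proof. exact: Im_sum. Qed.

Lemma Im_divc (z w : R[i]) :
  Im (z / w) = (Im z * Re w - Re z * Im w) / normc w ^+ 2.
Proof. by rewrite sqr_normcE ImM; case: w => c d /=; ring. Qed.

(** The imaginary part of the edge sum is a Riemann sum for the angle under
    which the origin sees that edge, so it has the sign of the determinant and
    is at most pi up to a discretization error. *)
Lemma Im_edge_sum L k (d := gen_det L) :
  exists2 s : R, Im (gen2 L * edge_sum L k) = d * s &
  0 <= `|d| * s <= pi + 4 * (normc (gen2 L) ^+ 2 / d) ^+ 2 / k.+1%:R.
Proof.
have d0 : d != 0 := gen_det_neq0 L.
have nd0 : 0 < `|d| by rewrite normr_gt0.
set kap : R := k%:R + 2^-1.
have kap0 : 0 < kap by rewrite ltr_wpDl // invr_gt0.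
pose q (i : 'I_k.*2.+1) := half_edge L k (i%:Z - k%:Z).
pose W := normc (gen2 L) ^+ 2.
have W0 : 0 < W.
  rewrite exprn_gt0 // normc_gt0; apply/eqP => e.
  by move: d0; rewrite /d /gen_det e /= !mulr0 subrr eqxx.
exists (\sum_i kap / normc (q i) ^+ 2).
  rewrite /edge_sum -symsumZ Im_symsum mulr_sumr; apply: eq_bigr => i _.
  rewrite Im_divc mulrA -/(q i); congr (_ / _).
  rewrite /q /half_edge /real_comb ReD ImD !ReM !ImM /= -/kap /d /gen_det.
  by ring.
rewrite mulr_ge0 ?sumr_ge0 //=; last first.
  by move=> i _; rewrite divr_ge0 ?sqr_ge0 // ltW.
pose b := kap * `|d| / W.
pose a := kap * ((Re (gen1 L) * Re (gen2 L) + Im (gen1 L) * Im (gen2 L)) / W) - k%:R.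
have b0 : 0 < b by rewrite divr_gt0 // mulr_gt0.
have WE : W = Re (gen2 L) ^+ 2 + Im (gen2 L) ^+ 2 by rewrite /W sqr_normcE.
(* Completing the square in i brings the summand into the form b / ((i + a)^2 + b^2). *)
have qE i : normc (q i) ^+ 2 = W * ((i%:R + a) ^+ 2 + b ^+ 2).
  have -> : b ^+ 2 = (kap / W) ^+ 2 * d ^+ 2.
    by rewrite /b -[d ^+ 2]real_normK ?num_real //; ring.
  rewrite sqr_normcE /q /half_edge /real_comb ReD ImD !ReM !ImM /= -/kap /a.
  rewrite rmorphB /= /d /gen_det -!pmulrn WE.
  by field; rewrite -WE gt_eqF.
have -> : `|d| * (\sum_i kap / normc (q i) ^+ 2) =
    \sum_(i < k.*2.+1) b / ((i%:R + a) ^+ 2 + b ^+ 2).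
  rewrite mulr_sumr; apply: eq_bigr => i _; rewrite qE invfM /b.
  by ring.
apply: (le_trans (poisson_sum_le _ _ b0)); rewrite lerD2l.
have -> : k.*2.+1%:R = 2 * kap by rewrite -muln2 -natr1 natrM /kap; field.
have -> : 2 * kap / b ^+ 2 = 2 * (W / d) ^+ 2 / kap.
  rewrite /b !expr_div_n exprMn real_normK ?num_real //.
  by field; rewrite d0 !gt_eqF.
rewrite -/W; move: ((W / d) ^+ 2) (sqr_ge0 (W / d)) => E E0.
rewrite ler_pdivrMr // mulrAC ler_pdivlMr // /kap -(natr1 k).
have := mulr_ge0 E0 (ler0n R k); lra.
Qed.

Lemma le_eventually (x y : nat -> R) (a b : R) :
  x k @[k --> \oo] --> a -> y k @[k --> \oo] --> b ->
  (forall k, x k <= y k) -> a <= b.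
Proof.
move=> xa yb xy; rewrite -(cvg_lim _ xa) // -(cvg_lim _ yb) //.
apply: ler_lim; [by apply/cvg_ex; exists a|by apply/cvg_ex; exists b|].
by near=> k; exact: xy.
Unshelve. all: by end_near. Qed.

(** The contributions of the lattice sums over full squares cancel, and the two
    pairs of opposite edges contribute, up to a common sign and a vanishing
    error, an angle between 0 and pi each. *)
Lemma legendre_Im_bound L c1 c2 (d := gen_det L) :
  ccvg (quasi_coef L) c1 -> ccvg (quasi_coef (swap_lattice L)) c2 ->
  0 <= Num.sg d * Im (gen2 L * c1 - gen1 L * c2) <= pi * 2.
Proof.
move=> h1 h2; set X := gen2 L * c1 - gen1 L * c2.
have hX : ccvg (fun k => gen2 L * edge_sum L k - gen1 L * edge_sum (swap_lattice L) k) X.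
  have := ccvgD (ccvgM (ccvg_cst (gen2 L)) h1)
                (ccvgN (ccvgM (ccvg_cst (gen1 L)) h2)).
  apply: (ccvg_eventually (K := 0)) => k _.
  by rewrite /quasi_coef square_inv2_swap /=; ring.
have [_ hI] := hX.
pose C1 := 4 * (normc (gen2 L) ^+ 2 / d) ^+ 2.
pose C2 := 4 * (normc (gen1 L) ^+ 2 / d) ^+ 2.
have sI : Num.sg d * Im (gen2 L * edge_sum L k - gen1 L * edge_sum (swap_lattice L) k)
    @[k --> \oo] --> Num.sg d * Im X by apply: cvgM => //; exact: cvg_cst.
have bound k : 0 <= Num.sg d * Im (gen2 L * edge_sum L k -
      gen1 L * edge_sum (swap_lattice L) k) <=
    pi + C1 / k.+1%:R + (pi + C2 / k.+1%:R).
  have [s1 e1 /andP[a1 b1]] := Im_edge_sum L k.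
  have [s2 e2 /andP[a2 b2]] := Im_edge_sum (swap_lattice L) k.
  rewrite gen_det_swap -/d /= in e1 e2 a1 b1 a2 b2.
  rewrite ImD ImN e1 e2 mulNr opprK -mulrDr mulrA -normrEsg mulrDr.
  rewrite normrN in a2 b2; rewrite invrN mulrN sqrrN in b2.
  by rewrite addr_ge0 //= lerD.
apply/andP; split.
  apply: le_eventually (cvg_cst 0) sI _ => k; by case/andP: (bound k).
have cC : pi + C1 / k.+1%:R + (pi + C2 / k.+1%:R) @[k --> \oo] --> pi + 0 + (pi + 0).
  by apply: cvgD; apply: cvgD; (exact: cvg_cst || exact: cvg_cst_div).
rewrite !addr0 -mulr2n -mulr_natr in cC.
by apply: le_eventually sI cC _ => k; case/andP: (bound k).
Qed.

(** Legendre's relation up to a period of exp: adding both generators to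
    minus the centre of the parallelogram gives the centre, where the odd
    function sigma takes the opposite, nonzero value. *)
Lemma cexp_legendre L c1 c2 :
  ccvg (quasi_coef L) c1 -> ccvg (quasi_coef (swap_lattice L)) c2 ->
  cexp (gen2 L * c1 - gen1 L * c2) = -1.
Proof.
move=> h1 h2.
pose h := real_comb L 2^-1 2^-1.
have hE : gen1 L + gen2 L = 2 * h.
  by rewrite /h /real_comb !fmorphV !rmorph_nat; field.
have hL : ~ lattice_set L h.
  by apply: notin_lattice => -[m [_ [e _]]]; exact: half_notint e.
have s1 := sigma_quasiperiodic (- h) h1.
have s2 := sigma_quasiperiodic (- h + gen1 L) h2.
rewrite weierstrass_sigma_swap /= in s2.
have e0 : - h + gen1 L + gen2 L = h by rewrite -addrA hE; ring.
have e1 : 2 * - h + gen1 L = - gen2 L.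
  by rewrite mulrN -hE; ring.
have e2 : 2 * (- h + gen1 L) + gen2 L = gen1 L.
  by rewrite mulrDr mulrN -hE; ring.
rewrite e0 e2 s1 e1 sigmaN mulNr opprK in s2.
have sn := sigma_neq0 hL.
rewrite cexpD; move: s2.
have -> : cexp (gen2 L * c1) = (cexp (- gen2 L * c1))^-1.
  by rewrite mulNr cexpN invrK.
have -> : cexp (- (gen1 L * c2)) = (cexp (gen1 L * c2))^-1 by rewrite cexpN.
have := cexp_neq0 (- gen2 L * c1); have := cexp_neq0 (gen1 L * c2).
move: (cexp (- gen2 L * c1)) (cexp (gen1 L * c2)) (weierstrass_sigma L h) sn.
move=> x y s s0 y0 x0 e.
have xy : x * y = -1.
  by apply: (mulfI s0); rewrite mulrN1 [in RHS]e; ring.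
by rewrite -invfM xy invrN1.
Qed.

(** By [cexp_legendre] the left-hand side is an odd multiple of i pi; only one
    such multiple satisfies [legendre_Im_bound]. *)
Lemma legendre_relation L c1 c2 (d := gen_det L) :
  ccvg (quasi_coef L) c1 -> ccvg (quasi_coef (swap_lattice L)) c2 ->
  gen2 L * c1 - gen1 L * c2 = (0 +i* (Num.sg d * pi))%C.
Proof.
move=> h1 h2; have E := cexp_legendre h1 h2.
have := legendre_Im_bound h1 h2; rewrite -/d /= => B.
move: (gen2 L * c1 - gen1 L * c2) E B => X E B.
have [ER EI] : expR (Re X) * cos (Im X) = -1 /\ expR (Re X) * sin (Im X) = 0.
  move: E; rewrite /cexp => /[dup] /(congr1 (@complex.Re R)) + /(congr1 (@complex.Im R)).
  by rewrite ReM ImM /= !mul0r subr0 addr0 oppr0.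
have RX : Re X = 0.
  have := normc_cexp X; rewrite E normcN normc1 => e.
  by apply: expR_inj; rewrite expR0.
rewrite RX expR0 !mul1r in ER EI.
apply: complex_eq => //=.
have sg1 : Num.sg d * Num.sg d = 1 by rewrite -expr2 sqr_sg gen_det_neq0.
set Y := Num.sg d * Im X in B.
have YE : Im X = Num.sg d * Y by rewrite /Y mulrA sg1 mul1r.
have cY : cos Y = -1.
  rewrite /Y -ER; have [d0|d0|d0] := ltrgtP d 0.
  - by rewrite ltr0_sg // mulN1r cosN.
  - by rewrite gtr0_sg // mul1r.
  - by have := gen_det_neq0 L; rewrite -/d d0 eqxx.
rewrite YE; congr (_ * _).
have : cos `|Y - pi| = cos 0.
  have -> : cos `|Y - pi| = cos (Y - pi).
    by have [_|_] := ger0P (Y - pi); rewrite ?cosN.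
  by rewrite -[LHS]opprK -cosDpi subrK cY cos0 opprK.
have p0 := pi_ge0 R.
move=> /cos_inj; rewrite !in_itv /= normr_ge0 lexx p0 /= => H.
have : `|Y - pi| = 0.
  apply: H => //; rewrite ler_norml; apply/andP; split; case/andP: B => *; lra.
by move/eqP; rewrite normr_eq0 subr_eq0 => /eqP.
Qed.

(** The increments of the exponents of e^(b z^2), of the quasi-periodicity
    factor and of e^(-|z|^2) under the shift are b w1 y, c1 y and
    -Re(conj(w1) y), with y = 2 z + w1. *)
Lemma modified_sigma_period1 L b c1 z :
  ccvg (quasi_coef L) c1 -> b * gen1 L + c1 = (gen1 L)^*%C ->
  let f u := expR (- normc u ^+ 2) *
             normc (cexp (b * u ^+ 2) * weierstrass_sigma L u) in
  f (z + gen1 L) = f z.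
Proof.
move=> h1 bE /=.
rewrite (sigma_quasiperiodic z h1) mulrN normcN.
rewrite [_ * cexp ((_ + _) * c1)]mulrC [cexp _ * (cexp _ * _)]mulrA -cexpD.
rewrite !(normcM (cexp _)) !normc_cexp ![expR _ * (expR _ * _)]mulrA -!expRD.
congr (expR _ * _).
have -> : b * (z + gen1 L) ^+ 2 + (2 * z + gen1 L) * c1 =
  b * z ^+ 2 + (2 * z + gen1 L) * (b * gen1 L + c1) by ring.
rewrite bE !sqr_normcE !(ReD, ImD, ReM, ImM) /=.
by case: (gen1 L) => p q /=; ring.
Qed.

(** The condition on b from the first generator determines it; the condition
    from the second one follows, because Legendre's relation and the value of
    the determinant agree. *)
Lemma modified_sigma_const_ex L : `|gen_det L| = pi / 2 ->
  exists b, modified_sigma_const_spec L b.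
Proof.
move=> dpi.
have [c1 h1] := quasi_coef_cvg L; have [c2 h2] := quasi_coef_cvg (swap_lattice L).
have X := legendre_relation h1 h2.
have g1 : gen1 L != 0.
  by apply/eqP => e; have := gen_det_neq0 L; rewrite /gen_det e /= !mul0r subrr eqxx.
pose b := ((gen1 L)^*%C - c1) / gen1 L.
have b1 : b * gen1 L + c1 = (gen1 L)^*%C by rewrite /b divfK // subrK.
have b2 : b * gen2 L + c2 = (gen2 L)^*%C.
  apply: (mulIf g1); rewrite mulrDl mulrAC /b divfK //.
  have sgE : Num.sg (gen_det L) * pi = 2 * gen_det L.
    by rewrite {2}[gen_det L]numEsg dpi; field.
  rewrite sgE in X.
  have C : (gen1 L)^*%C * gen2 L - (gen2 L)^*%C * gen1 L = (0 +i* (2 * gen_det L))%C.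
    apply: complex_eq; rewrite !(ReD, ImD, ReN, ImN, ReM, ImM) /gen_det;
    case: (gen1 L) => ? ?; case: (gen2 L) => ? ? /=; ring.
  rewrite mulrBl; apply/eqP; rewrite -subr_eq0; apply/eqP.
  transitivity ((gen1 L)^*%C * gen2 L - (gen2 L)^*%C * gen1 L -
    (gen2 L * c1 - gen1 L * c2)); first by ring.
  by rewrite C X subrr.
exists b => z w [m [n ->]] f.
have f1 u : f (u + gen1 L) = f u by exact: (modified_sigma_period1 u h1 b1).
have f2 u : f (u + gen2 L) = f u.
  have := @modified_sigma_period1 (swap_lattice L) b c2 u h2 b2.
  by rewrite weierstrass_sigma_swap.
have perZ (g : R[i]) : (forall u, f (u + g) = f u) ->
    forall (j : int) u, f (u + j%:~R * g) = f u.
  move=> fg; have fN j u : f (u + j%:R * g) = f u.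
    elim: j u => [|j IH] u; first by rewrite mul0r addr0.
    by rewrite -natr1 mulrDl mul1r addrA fg IH.
  case=> j u; first exact: fN.
  have := fN j.+1 (u - j.+1%:R * g); rewrite subrK => ->.
  by rewrite NegzE mulrNz mulNr.
by rewrite /lattice_point addrA !perZ.
Qed.

End Legendre.

(** * Area and the covolume of a lattice *)

Section Plane.
Context {R : realType}.
Local Notation line := (measurableTypeR R).
Local Notation plane := (measurableTypeR R * measurableTypeR R)%type.
Local Notation mu := (@lebesgue_measure R).
Local Notation area := (@lebesgue_measure R \x @lebesgue_measure R)%E.

Definition line_shift (a : R) (x : line) : line := x + a.

Lemma measurable_line_shift (a : R) : measurable_fun setT (line_shift a).
Proof. by apply: measurable_funD => //; exact: measurable_cst. Qed.

HB.instance Definition _ a :=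
  isMeasurableFun.Build _ _ line line (line_shift a) (measurable_line_shift a).

Lemma lebesgue_measure_shift (a : R) (A : set line) : measurable A ->
  mu (line_shift a @^-1` A) = mu A.
Proof.
move=> mA.
rewrite -[LHS]/(pushforward mu (line_shift a) A).
apply/esym/lebesgue_measure_unique => //= _ [[p q]] _ <-.
rewrite /pushforward /=.
have -> : line_shift a @^-1` `]p, q]%classic = `]p - a, q - a]%classic.
  by apply/seteqP; split => x /=; rewrite /line_shift !in_itv /= ltrBlDr lerBrDr.
rewrite !lebesgue_measure_itv /= !lte_fin ltrD2r.
by case: ifP => // _; rewrite -!EFinB; congr (_%:E); ring.
Qed.

Lemma measurable_linear_form (a b c : R) :
  measurable_fun setT (fun p : plane => (a * p.1 + b * p.2 + c : line)).
Proof.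
apply: measurable_funD; last exact: measurable_cst.
apply: measurable_funD; apply: measurable_funM; rewrite //.
Qed.

Definition translate (v : R[i]) (p : plane) : plane := (p.1 + Re v, p.2 + Im v).

Lemma measurable_translate v : measurable_fun setT (translate v).
Proof.
apply: measurable_fun_pair.
- exact: measurableT_comp (measurable_line_shift _) measurable_fst.
- exact: measurableT_comp (measurable_line_shift _) measurable_snd.
Qed.

HB.instance Definition _ v :=
  isMeasurableFun.Build _ _ plane plane (translate v) (measurable_translate v).

Lemma measurable_translate_preimage v (D : set plane) : measurable D ->
  measurable (translate v @^-1` D).
Proof.
move=> mD; rewrite -[X in measurable X]setTI.
exact: measurable_translate.
Qed.

(** A translation of the plane acts on rectangles through translations of the
    two factors, and a product measure is determined on rectangles. *)
Lemma area_translate v (A : set plane) : measurable A ->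
  area (translate v @^-1` A) = area A.
Proof.
move=> mA.
rewrite -[LHS]/(pushforward area (translate v) A).
apply/esym/product_measure_unique => //= B C mB mC.
rewrite /pushforward /=.
have -> : translate v @^-1` (B `*` C) =
   (line_shift (Re v) @^-1` B) `*` (line_shift (Im v) @^-1` C).
  by apply/seteqP; split=> -[].
rewrite product_measure1E; first by congr (_ * _)%E; exact: lebesgue_measure_shift.
- by rewrite -[X in measurable X]setTI; apply: measurable_line_shift.
- by rewrite -[X in measurable X]setTI; apply: measurable_line_shift.
Qed.

Lemma area_shear_y (c : R) (A : set plane) : measurable A ->
  area ((fun p : plane => (p.1, p.2 + c * p.1) : plane) @^-1` A) = area A.
Proof.
move=> mA; apply: eq_integral => x _ /=.
rewrite -(lebesgue_measure_shift (c * x) (measurable_xsection x mA)).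
by congr (mu _); apply/seteqP; split => y; rewrite /xsection /= !inE.
Qed.

Lemma area_shear_x (c : R) (A : set plane) : measurable A ->
  area ((fun p : plane => (p.1 + c * p.2, p.2) : plane) @^-1` A) = area A.
Proof.
have swap X : measurable X -> area X = (mu \x^ mu)%E X.
  by apply: product_measure_unique => B C mB mC; exact: product_measure2E.
move=> mA; rewrite !swap //; last first.
  rewrite -[X in measurable X]setTI; apply: measurable_fun_pair => //.
  apply: measurable_funD; first exact: measurable_fst.
  by apply: measurable_funM => //; exact: measurable_cst.
apply: eq_integral => y _ /=.
rewrite -(lebesgue_measure_shift (c * y) (measurable_ysection y mA)).
by congr (mu _); apply/seteqP; split => x; rewrite /ysection /= !inE.
Qed.

Definition half_open_segment (e : R) : set line :=
  [set x | exists2 s, 0 <= s < 1 & x = s * e].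

Lemma half_open_segmentE (e : R) : e != 0 -> half_open_segment e =
  (if 0 < e then `[0, e[ else `]e, 0])%classic.
Proof.
move=> e0; have [ep|en] := ltP 0 e; apply/seteqP; split => x /=; rewrite in_itv /=.
- move=> [s /andP[s0 s1] ->]; rewrite mulr_ge0 ?(ltW ep) //=.
  by rewrite -[X in _ < X]mul1r ltr_pM2r.
- move=> /andP[x0 xe]; exists (x / e); last by rewrite divfK.
  by rewrite divr_ge0 ?(ltW ep) //= ltr_pdivrMr ?mul1r.
- have {}en : e < 0 by rewrite lt_neqAle e0.
  move=> [s /andP[s0 s1] ->]; rewrite mulr_ge0_le0 ?(ltW en) // andbT.
  by rewrite -[X in X < _]mul1r ltr_nM2r.
- have {}en : e < 0 by rewrite lt_neqAle e0.
  move=> /andP[x0 xe]; exists (x / e); last by rewrite divfK.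
  by rewrite ltr_ndivrMr // mul1r x0 andbT mulr_le0 // invr_le0 ltW.
Qed.

Lemma measurable_half_open_segment (e : R) : e != 0 -> measurable (half_open_segment e).
Proof. by move=> /half_open_segmentE ->; case: ifP => _; exact: measurable_itv. Qed.

Lemma lebesgue_half_open_segment (e : R) : e != 0 ->
  mu (half_open_segment e) = `|e|%:E.
Proof.
move=> e0; rewrite half_open_segmentE //; have [ep|en] := ltP 0 e.
  by rewrite lebesgue_measure_itv /= lte_fin ep oppr0 adde0 gtr0_norm.
rewrite lebesgue_measure_itv /= lte_fin lt_neqAle e0 en /= add0e.
by rewrite ler0_norm.
Qed.

Implicit Type L : lattice R.

Lemma measurable_fund_parallelogram L :
  measurable (fund_parallelogram L : set plane).
Proof.
have D0 := gen_det_neq0 L; set d := gen_det L in D0.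
pose f (p : plane) : plane :=
  ((Im (gen2 L) / d) * p.1 + (- Re (gen2 L) / d) * p.2 + 0,
   (- Im (gen1 L) / d) * p.1 + (Re (gen1 L) / d) * p.2 + 0).
have -> : fund_parallelogram L = setT `&` f @^-1` (`[0, 1[%classic `*` `[0, 1[%classic).
  rewrite setTI; apply/seteqP; split => -[x y]; rewrite /f /=.
  - move=> [s [t [s01 t01 /[dup] /(congr1 (@complex.Re R)) + /(congr1 (@complex.Im R))]]].
    rewrite !(ReD, ImD, ReM, ImM) /= !mul0r !subr0 !addr0 => -> ->.
    have -> : Im (gen2 L) / d * (s * Re (gen1 L) + t * Re (gen2 L)) +
        - Re (gen2 L) / d * (s * Im (gen1 L) + t * Im (gen2 L)) = s.
      by move: D0; rewrite /d /gen_det => D0; field; exact: D0.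
    have -> : - Im (gen1 L) / d * (s * Re (gen1 L) + t * Re (gen2 L)) +
        Re (gen1 L) / d * (s * Im (gen1 L) + t * Im (gen2 L)) = t.
      by move: D0; rewrite /d /gen_det => D0; field; exact: D0.
    by rewrite !in_itv.
  - rewrite !addr0 !in_itv /= => -[s01 t01]; do 2 eexists; split; [exact: s01|exact: t01|].
    apply: complex_eq; rewrite !(ReD, ImD, ReM, ImM) /= !mul0r ?subr0 ?addr0;
    move: D0; rewrite /d /gen_det => D0; field; exact: D0.
apply: measurable_fun_pair; [exact: measurable_linear_form|exact: measurable_linear_form|by []|].
by apply: measurableX; exact: measurable_itv.
Qed.

Lemma fund_parallelogram_swap L :
  fund_parallelogram (swap_lattice L) = fund_parallelogram L.
Proof.
by apply/seteqP; split => p [s [t [? ? E]]]; exists t, s; split => //;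
  rewrite E addrC.
Qed.

(** Two shears turn the parallelogram into a rectangle with the same
    determinant. *)
Lemma covolumeE L : covolume L = `|gen_det L|%:E.
Proof.
wlog x10 : L / Re (gen1 L) != 0.
  move=> H; have [e|] := eqVneq (Re (gen1 L)) 0; last exact: H.
  have := H (swap_lattice L); rewrite gen_det_swap normrN /covolume.
  rewrite fund_parallelogram_swap /=; apply.
  by apply: contra_neq (gen_det_neq0 L) => e'; rewrite /gen_det e e' mul0r mulr0 subrr.
have D0 := gen_det_neq0 L; set d := gen_det L in D0 *.
pose e := d / Re (gen1 L).
have e0 : e != 0 by rewrite mulf_neq0 // invr_eq0.
rewrite /covolume -(area_shear_y (Im (gen1 L) / Re (gen1 L)) (measurable_fund_parallelogram L)).
set A := _ @^-1` _.
have mA : measurable A.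
  rewrite /A -[X in measurable X]setTI.
  apply: measurable_fun_pair => //; last exact: measurable_fund_parallelogram.
  apply: measurable_funD; first exact: measurable_snd.
  by apply: measurable_funM => //; exact: measurable_cst.
rewrite -(area_shear_x (Re (gen2 L) / e) mA).
rewrite (_ : _ @^-1` A = half_open_segment (Re (gen1 L)) `*` half_open_segment e).
  rewrite product_measure1E; [|exact: measurable_half_open_segment..].
  have x1m := lebesgue_half_open_segment x10; have em := lebesgue_half_open_segment e0.
  transitivity (`|Re (gen1 L)|%:E * `|e|%:E)%E; first exact: congr2 x1m em.
  rewrite -EFinM -normrM /e.
  by rewrite mulrC divfK.
apply/seteqP; split => -[x y] /=.
- move=> [s [t [s01 t01 /[dup] /(congr1 (@complex.Re R)) + /(congr1 (@complex.Im R))]]].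
  rewrite !(ReD, ImD, ReM, ImM) /= !mul0r !subr0 !addr0 => E1 E2.
  have yE : y = t * e.
    have -> : y = (s * Im (gen1 L) + t * Im (gen2 L)) -
       Im (gen1 L) / Re (gen1 L) * (s * Re (gen1 L) + t * Re (gen2 L)).
      by rewrite -E1 -E2; ring.
    by rewrite /e /d /gen_det; field.
  split; [exists s|exists t] => //=.
  have -> : x = s * Re (gen1 L) + t * Re (gen2 L) - Re (gen2 L) / e * y by rewrite -E1; ring.
  by rewrite yE; field.
- move=> [[s s01 ->] [t t01 ->]]; exists s, t; split => //.
  apply: complex_eq; rewrite !(ReD, ImD, ReM, ImM) /= !mul0r ?subr0 ?addr0.
    by field.
  have -> : Re (gen2 L) / e * (t * e) = Re (gen2 L) * t by field.
  by rewrite /e /d /gen_det; field.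
Qed.

End Plane.

(** * Integration of periodic functions *)

Section TorusIntegral.
Context {R : realType}.
Local Notation line := (measurableTypeR R).
Local Notation plane := (measurableTypeR R * measurableTypeR R)%type.
Local Notation area := (@lebesgue_measure R \x @lebesgue_measure R)%E.
Implicit Type L : lattice R.

Definition cplx (p : plane) : R[i] := (p.1 +i* p.2)%C.

Lemma cplx_translate v p : cplx (translate v p) = cplx p + v.
Proof. by case: v. Qed.

Lemma ge0_integral_translate v (D : set plane) (f : plane -> \bar R) :
  measurable D -> measurable_fun setT f -> (forall p, (0 <= f p)%E) ->
  (\int[area]_(p in translate v @^-1` D) f (translate v p) =
   \int[area]_(p in D) f p)%E.
Proof.
move=> mD mf f0.
have mfD : measurable_fun D f by exact: measurable_funTS.
have := @ge0_integral_pushforward _ _ plane plane R _ (measurable_translate v)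
  area D f mD mfD (fun p _ => f0 p).
move=> <-; apply: eq_measure_integral => A mA _; exact: area_translate.
Qed.

Lemma fund_tile L z : exists m n, fund_parallelogram L
  (Re (z - lattice_point L m n), Im (z - lattice_point L m n)).
Proof.
have D0 := gen_det_neq0 L.
(* The real coordinates of z in the basis of the generators, by Cramer's rule. *)
pose s := (Im (gen2 L) * Re z - Re (gen2 L) * Im z) / gen_det L.
pose t := (Re (gen1 L) * Im z - Im (gen1 L) * Re z) / gen_det L.
have zE : z = real_comb L s t.
  apply: complex_eq; rewrite /real_comb !(ReD, ImD, ReM, ImM) /= !mul0r ?subr0 ?addr0;
  rewrite /s /t; move: D0; rewrite /gen_det => D0; field; exact: D0.
exists (Num.floor s), (Num.floor t).
exists (s - (Num.floor s)%:~R), (t - (Num.floor t)%:~R); split.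
- by rewrite subr_ge0 ltrBlDl floor_le /= -intrD1 floorD1_gt.
- by rewrite subr_ge0 ltrBlDl floor_le /= -intrD1 floorD1_gt.
rewrite [LHS](_ : _ = z - lattice_point L (Num.floor s) (Num.floor t)); last first.
  by case: (z - _).
by rewrite lattice_pointE zE /real_comb !rmorphB /=; ring.
Qed.

Lemma fund_tile_unique L z m n m' n' :
  fund_parallelogram L (Re (z - lattice_point L m n), Im (z - lattice_point L m n)) ->
  fund_parallelogram L (Re (z - lattice_point L m' n'), Im (z - lattice_point L m' n')) ->
  (m, n) = (m', n').
Proof.
have E w : ((Re w, Im w).1 +i* (Re w, Im w).2)%C = w by case: w.
move=> [s [t [/andP[s0 s1] /andP[t0 t1]]]] + [s' [t' [/andP[s0' s1'] /andP[t0' t1']]]].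
rewrite !E => e1 e2.
have : real_comb L (s + m%:~R) (t + n%:~R) = real_comb L (s' + m'%:~R) (t' + n'%:~R).
  transitivity z.
    by rewrite -[RHS](subrK (lattice_point L m n)) e1 lattice_pointE /real_comb !rmorphD /=; ring.
  by rewrite -[LHS](subrK (lattice_point L m' n')) e2 lattice_pointE /real_comb !rmorphD /=; ring.
move=> /real_comb_inj[es et].
have int_eq (a b : R) (i j : int) : 0 <= a -> a < 1 -> 0 <= b -> b < 1 ->
    a + i%:~R = b + j%:~R -> i = j.
  move=> a0 a1 b0 b1 ab.
  have h1 : (i - j)%:~R < 1%:~R :> R by rewrite intrB; lra.
  have h2 : (j - i)%:~R < 1%:~R :> R by rewrite intrB; lra.
  by move: h1 h2; rewrite !ltr_int; clear; lia.
by rewrite (int_eq _ _ _ _ s0 s1 s0' s1' es) (int_eq _ _ _ _ t0 t1 t0' t1' et).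
Qed.

(** A translated fundamental domain is cut along the lattice into pieces which
    lattice translations reassemble into the original one. *)
Lemma torus_integral_translate L (f : R[i] -> \bar R) (alpha : R[i]) :
  (forall z, (0 <= f z)%E) ->
  measurable_fun setT (fun p : plane => f (cplx p)) ->
  (forall z m n, f (z + lattice_point L m n) = f z) ->
  torus_integral L (fun z => f (z - alpha)) = torus_integral L f.
Proof.
move=> f0 mf fper.
pose P : set plane := fund_parallelogram L.
have mP : measurable P := measurable_fund_parallelogram L.
pose Q := translate alpha @^-1` P.
have mQ : measurable Q by exact: measurable_translate_preimage.
pose g (p : plane) := f (cplx p).
have PQ : P = translate (- alpha) @^-1` Q.
  apply/seteqP; split => -[x y]; rewrite /Q /translate /= ReN ImN !subrK //.
have -> : torus_integral L (fun z => f (z - alpha)) = (\int[area]_(p in Q) g p)%E.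
  transitivity (\int[area]_(p in P) g (translate (- alpha)%R p))%E; last first.
    rewrite PQ.
    exact: (@ge0_integral_translate (- alpha) Q g mQ mf (fun p => f0 _)).
  by apply: eq_integral => p _; rewrite /g cplx_translate.
pose w (x : int * int) := lattice_point L x.1 x.2.
(* F k and G k are the same piece of the plane, up to the translation by the
   lattice point number k: the F k tile Q and the G k tile P. *)
pose G k := if @pickle_inv (int * int)%type k is Some x
            then P `&` translate (w x) @^-1` Q else set0.
pose F k := if @pickle_inv (int * int)%type k is Some x
            then Q `&` translate (- w x) @^-1` P else set0.
have mG k : measurable (G k).
  rewrite /G; case: pickle_inv => // x; apply: measurableI => //.
  exact: measurable_translate_preimage.
have mF k : measurable (F k).
  rewrite /F; case: pickle_inv => // x; apply: measurableI => //.
  exact: measurable_translate_preimage.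
have FG k : (\int[area]_(p in F k) g p = \int[area]_(p in G k) g p)%E.
  have FGE x : Q `&` translate (- w x) @^-1` P =
      translate (- w x) @^-1` (P `&` translate (w x) @^-1` Q).
    rewrite preimage_setI setIC; congr (_ `&` _); apply/seteqP.
    by split => -[a b]; rewrite /translate /= ReN ImN !subrK.
  have := mG k; rewrite /F /G; case: pickle_inv => [x mGx|_ //].
  rewrite FGE -(@ge0_integral_translate (- w x) _ g mGx mf (fun p => f0 _)).
  apply: eq_integral => p _; rewrite /g cplx_translate.
  by rewrite -[in LHS](subrK (w x) (cplx p)) fper.
have inv_inj (i j : nat) (x : int * int) :
    pickle_inv i = Some x -> pickle_inv j = Some x -> i = j.
  move=> e e'; have := @pickle_invK (int * int)%type i; rewrite e /= => <-.
  by have := @pickle_invK (int * int)%type j; rewrite e' /= => <-.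
have transE v (p : plane) : translate v p = (Re (cplx p + v), Im (cplx p + v)).
  by rewrite ReD ImD; case: p.
have tF : trivIset setT F.
  apply/trivIsetP => k k' _ _ kk'; apply/seteqP; split => // p [].
  rewrite /F; case ek: pickle_inv => [[m n]|] // [_ /= h].
  case ek': pickle_inv => [[m' n']|] // [_ /= h'].
  rewrite !transE in h h'; have e := fund_tile_unique h h'.
  by move/eqP: kk'; apply; apply: inv_inj ek _; rewrite e.
have tG : trivIset setT G.
  apply/trivIsetP => k k' _ _ kk'; apply/seteqP; split => // p [].
  rewrite /G; case ek: pickle_inv => [[m n]|] // [_ /= h].
  case ek': pickle_inv => [[m' n']|] // [_ /= h'].
  rewrite /Q /= !transE in h h'.
  have NN a b : cplx p + lattice_point L a b + alpha =
      cplx p + alpha - lattice_point L (- a) (- b).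
    by rewrite lattice_pointN opprK addrAC.
  have cE a : cplx (Re a, Im a) = a by case: a.
  rewrite !cE /w /= !NN in h h'.
  have [e1 e2] := fund_tile_unique h h'.
  by move/eqP: kk'; apply; apply: inv_inj ek _;
    rewrite ek' (oppr_inj e1) (oppr_inj e2).
have UF : \bigcup_k F k = Q.
  apply/seteqP; split => [p [k _]|p Qp].
    by rewrite /F; case: pickle_inv => [x []|].
  have [m [n h]] := fund_tile L (cplx p).
  exists (pickle ((m, n) : int * int)); first by [].
  rewrite /F pickleK_inv; split; first exact: Qp.
  by rewrite /preimage /mkset transE.
have UG : \bigcup_k G k = P.
  apply/seteqP; split => [p [k _]|p Pp].
    by rewrite /G; case: pickle_inv => [x []|].
  have [m [n h]] := fund_tile L (cplx p + alpha).
  exists (pickle ((- m, - n) : int * int)); first by [].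
  rewrite /G pickleK_inv; split; first exact: Pp.
  rewrite /Q /preimage /mkset !transE.
  have cE a : cplx (Re a, Im a) = a by case: a.
  by rewrite cE /w /= lattice_pointN addrAC.
have mg (D : set plane) : measurable_fun D g by exact: measurable_funTS.
have eF : (\int[area]_(p in Q) g p = \sum_(i <oo) \int[area]_(p in F i) g p)%E.
  by rewrite -UF; apply: ge0_integral_bigcup => // p _; exact: f0.
have eG : (\int[area]_(p in P) g p = \sum_(i <oo) \int[area]_(p in G i) g p)%E.
  by rewrite -UG; apply: ge0_integral_bigcup => // p _; exact: f0.
rewrite eF (eq_eseriesr (g := fun i => \int[area]_(p in G i) g p)%E); last first.
  by move=> i _; exact: FG.
exact: esym eG.
Qed.

(** * Measurability of sigma *)

Definition cmeasurable (g : plane -> R[i]) :=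
  measurable_fun setT (fun p => Re (g p)) /\ measurable_fun setT (fun p => Im (g p)).

Lemma cmeasurable_cplx : cmeasurable cplx.
Proof. by split; [exact: measurable_fst|exact: measurable_snd]. Qed.

Lemma cmeasurable_cst z : cmeasurable (fun=> z).
Proof. by split; exact: measurable_cst. Qed.

Lemma cmeasurableD f g : cmeasurable f -> cmeasurable g ->
  cmeasurable (fun p => f p + g p).
Proof.
move=> [f1 f2] [g1 g2]; split.
- by under eq_fun do rewrite ReD; exact: measurable_funD.
- by under eq_fun do rewrite ImD; exact: measurable_funD.
Qed.

Lemma cmeasurableM f g : cmeasurable f -> cmeasurable g ->
  cmeasurable (fun p => f p * g p).
Proof.
move=> [f1 f2] [g1 g2]; split.
- by under eq_fun do rewrite ReM; apply: measurable_funB; exact: measurable_funM.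
- by under eq_fun do rewrite ImM; apply: measurable_funD; exact: measurable_funM.
Qed.

Lemma cmeasurable_cexp f : cmeasurable f -> cmeasurable (fun p => cexp (f p)).
Proof.
move=> [f1 f2].
have me := measurableT_comp (@measurable_expR R) f1.
have mc := measurableT_comp (continuous_measurable_fun (@continuous_cos R)) f2.
have ms := measurableT_comp (continuous_measurable_fun (@continuous_sin R)) f2.
split.
- under eq_fun do rewrite /cexp ReM /= mul0r subr0; exact: measurable_funM.
- under eq_fun do rewrite /cexp ImM /= mul0r addr0; exact: measurable_funM.
Qed.

Lemma cmeasurable_prod n (f : 'I_n -> plane -> R[i]) :
  (forall i, cmeasurable (f i)) -> cmeasurable (fun p => \prod_i f i p).
Proof.
elim: n f => [|n IH] f h.
  by under eq_fun do rewrite big_ord0; exact: cmeasurable_cst.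
under eq_fun do rewrite big_ord_recl; apply: cmeasurableM => //.
exact: IH.
Qed.

Lemma measurable_normc f : cmeasurable f -> measurable_fun setT (fun p => normc (f p)).
Proof.
move=> [f1 f2]; under eq_fun do rewrite normcE.
apply: (measurableT_comp (continuous_measurable_fun (@sqrt_continuous R))).
by apply: measurable_funD; exact: measurable_funX.
Qed.

Lemma measurable_weierstrass_sigma L :
  measurable_fun setT (fun p : plane => normc (weierstrass_sigma L (cplx p))).
Proof.
apply: (measurable_fun_cvg (h := fun k p => normc (sigma_partial L (cplx p) k))).
  move=> k; apply: measurable_normc.
  under eq_fun do rewrite sigma_partialE.
  apply: cmeasurableM; first exact: cmeasurable_cplx.
  apply: cmeasurable_prod => i; apply: cmeasurable_prod => j.
  have mz : cmeasurable (fun p => cplx p / lattice_point L (i%:Z - k%:Z) (j%:Z - k%:Z)).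
    by apply: cmeasurableM; [exact: cmeasurable_cplx|exact: cmeasurable_cst].
  apply: cmeasurableM.
    apply: cmeasurableD; first exact: cmeasurable_cst.
    under eq_fun do rewrite -mulN1r.
    by apply: cmeasurableM; first exact: cmeasurable_cst.
  have mq := cmeasurableM (cmeasurableM mz mz) (cmeasurable_cst 2^-1).
  exact: cmeasurable_cexp (cmeasurableD mz mq).
by move=> p _; apply: ccvg_normc; exact: sigma_cvg.
Qed.

(** * Pseudopolynomials *)

Definition sigma_modulus L (z : R[i]) : R :=
  expR (- normc z ^+ 2) * normc (modified_sigma L z).

Lemma sigma_modulus_ge0 L z : 0 <= sigma_modulus L z.
Proof. by rewrite mulr_ge0 ?expR_ge0 ?normc_ge0. Qed.

Lemma measurable_sigma_modulus L :
  measurable_fun setT (fun p : plane => sigma_modulus L (cplx p)).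
Proof.
apply: measurable_funM.
  apply: (measurableT_comp (@measurable_expR R)).
  apply: measurable_funN; apply: measurable_funX; apply: measurable_normc.
  exact: cmeasurable_cplx.
under eq_fun do rewrite /modified_sigma normcM.
apply: measurable_funM; last exact: measurable_weierstrass_sigma.
apply: measurable_normc; apply: cmeasurable_cexp; apply: cmeasurableM.
  exact: cmeasurable_cst.
by under eq_fun do rewrite expr2; apply: cmeasurableM; exact: cmeasurable_cplx.
Qed.

Lemma sigma_modulus_periodic L z m n : covolume L = (pi / 2)%:E ->
  sigma_modulus L (z + lattice_point L m n) = sigma_modulus L z.
Proof.
rewrite covolumeE => -[/modified_sigma_const_ex ex].
have := xgetPex 0 ex; rewrite -/(modified_sigma_const L) => spec.
by apply: spec; exists m, n.
Qed.

Lemma normc_pseudopoly1 L alpha z :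
  normc (pseudopoly1 L alpha z) = sigma_modulus L (z - alpha).
Proof.
rewrite /pseudopoly1 normcM normcM normc_cexp normc_real ger0_norm ?expR_ge0 //.
rewrite (_ : Re _ = 0) ?expR0 ?mul1r //.
by rewrite !ReM !ImM /= !(mul0r, mulr0, subr0, addr0, subrr, oppr0).
Qed.

Lemma powR_prod I (r : seq I) (F : I -> R) (b : R) : (forall i, 0 <= F i) ->
  (\prod_(i <- r) F i) `^ b = \prod_(i <- r) F i `^ b.
Proof.
move=> F0; elim: r => [|i r IH]; first by rewrite !big_nil powR1.
by rewrite !big_cons powRM ?IH // prodr_ge0.
Qed.

Lemma pseudopoly_powR L N (alpha : 'I_N -> R[i]) z b :
  normc (pseudopoly L alpha z) `^ b = \prod_j sigma_modulus L (z - alpha j) `^ b.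
Proof.
rewrite /pseudopoly normc_prod -powR_prod => [|i]; last exact: sigma_modulus_ge0.
by congr (_ `^ _); apply: eq_bigr => j _; rewrite normc_pseudopoly1.
Qed.

(** Where sigma_* vanishes at z - w, the potential is -oo, and both sides are 0
    because b is positive. *)
Lemma expeR_torus_potential L b z w : 0 < b ->
  expeR (b%:E * torus_potential L z w)%E =
  (sigma_modulus L (z - w) `^ b * expR (- (b * A_const L)))%:E.
Proof.
move=> b0; rewrite /torus_potential /log_modified_sigma /sigma_modulus.
set u := z - w; set r := normc (modified_sigma L u).
have [r0|r0] := eqVneq r 0.
  by rewrite r0 le0_lneNy //= gt0_muleNy ?lte_fin //= mulr0 powR0 ?gt_eqF // mul0r.
have {}r0 : 0 < r by rewrite lt0r r0 normc_ge0.
have e0 := expR_gt0 (- normc u ^+ 2).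
rewrite lne_EFin //= /powR mulf_eq0 !gt_eqF //= -expRD; congr (expR _)%:E.
by rewrite lnM ?posrE // expRK; ring.
Qed.

Lemma expeR_sum_torus_potential L N b z (w : 'I_N -> R[i]) : 0 < b ->
  expeR (\sum_(j < N) b%:E * torus_potential L z (w j))%E =
  ((expR (- (N%:R * b * A_const L)))%:E *
   (\prod_j sigma_modulus L (z - w j) `^ b)%R%:E)%E.
Proof.
move=> b0.
transitivity (\prod_(j < N)
    (sigma_modulus L (z - w j) `^ b * expR (- (b * A_const L))))%:E.
  elim/big_rec2: _ => [|j x y _ IH]; first by rewrite expeR0.
  by rewrite expeRD IH expeR_torus_potential.
rewrite big_split /= prodr_const card_ord -EFinM mulrC; congr (_ * _)%:E.
by rewrite -expRM_natl; congr expR; ring.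
Qed.

(** The inequality between the arithmetic and geometric means of the N-th
    powers. *)
Lemma prod_le_mean_pow N (x : 'I_N -> R) : (0 < N)%N -> (forall j, 0 <= x j) ->
  \prod_j x j <= \sum_j N%:R^-1 * x j ^+ N.
Proof.
move=> N0 x0.
have [+ _] := leif_AGM (A := predT) (E := fun j : 'I_N => x j ^+ N)
  (fun j _ => exprn_ge0 N (x0 j)).
rewrite -[X in X ^+ _]/(_ / _) cardE -cardE card_ord prodrXl.
rewrite ler_pXn2r ?nnegrE ?prodr_ge0 // ?divr_ge0 ?sumr_ge0 // => [|j _]; last exact: exprn_ge0.
by rewrite mulrC mulr_sumr.
Qed.

Lemma measurable_sigma_modulus_shift L b alpha :
  measurable_fun setT (fun p : plane => sigma_modulus L (cplx p - alpha) `^ b).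
Proof.
have -> : (fun p : plane => sigma_modulus L (cplx p - alpha) `^ b) =
    ((@powR R)^~ b \o (fun p => sigma_modulus L (cplx p))) \o translate (- alpha).
  by apply/funext => p /=; rewrite cplx_translate.
apply: measurableT_comp; last exact: measurable_translate.
exact: measurableT_comp (@measurable_powR R b) (measurable_sigma_modulus L).
Qed.

Lemma torus_integral_sigma_modulus L b alpha : covolume L = (pi / 2)%:E ->
  torus_integral L (fun z => (sigma_modulus L (z - alpha) `^ b)%:E) =
  torus_integral L (fun z => (sigma_modulus L z `^ b)%:E).
Proof.
move=> covL.
apply: (@torus_integral_translate L (fun z => (sigma_modulus L z `^ b)%:E)).
- by move=> z; rewrite lee_fin powR_ge0.
- apply/measurable_EFinP.
  exact: measurableT_comp (@measurable_powR R b) (measurable_sigma_modulus L).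
- by move=> z m n; rewrite sigma_modulus_periodic.
Qed.

Lemma torus_integralZl L (c : R) (f : R[i] -> R) : 0 <= c -> (forall z, 0 <= f z) ->
  measurable_fun setT (fun p : plane => f (cplx p)) ->
  torus_integral L (fun z => c%:E * (f z)%:E)%E =
  (c%:E * torus_integral L (fun z => (f z)%:E))%E.
Proof.
move=> c0 f0 mf; apply: ge0_integralZl_EFin => //.
- exact: measurable_fund_parallelogram.
- by move=> p _; rewrite lee_fin.
- by apply: measurable_funTS; exact/measurable_EFinP.
Qed.

Lemma measurable_pseudopoly L N (alpha : 'I_N -> R[i]) b :
  measurable_fun setT (fun p : plane => normc (pseudopoly L alpha (cplx p)) `^ b).
Proof.
under eq_fun do rewrite pseudopoly_powR.
elim: N alpha => [|N IH] alpha.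
  by under eq_fun do rewrite big_ord0; exact: measurable_cst.
under eq_fun do rewrite big_ord_recl.
apply: measurable_funM; first exact: measurable_sigma_modulus_shift.
exact: IH.
Qed.

Lemma pi_expR_cancel (a : R) (x : \bar R) :
  ((pi / 2 * expR a)%:E * ((2 / pi)%:E * ((expR (- a))%:E * x)) = x)%E.
Proof.
rewrite !muleA -!EFinM (_ : _ * _ = 1) ?mul1e //.
rewrite expRN; have p0 := lt0r_neq0 (pi_gt0 R); have e0 := lt0r_neq0 (expR_gt0 a).
move: (expR a) (pi : R) e0 p0 => e p e0 p0.
by field; rewrite p0 e0.
Qed.

(** The roots of the pseudopolynomial are one of the configurations in the
    infimum, and its norm is the corresponding value. *)
Lemma packing_number_le L N (alpha : 'I_N -> R[i]) b : 0 < b ->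
  ((pi / 2 * expR (N%:R * b * A_const L))%:E * packing_number L N b
     <= torus_Lnorm_pow L b (pseudopoly L alpha))%E.
Proof.
move=> b0.
rewrite -[leRHS](pi_expR_cancel (N%:R * b * A_const L)).
apply: lee_wpmul2l; first by rewrite lee_fin mulr_ge0 ?expR_ge0 // divr_ge0 // pi_ge0.
apply: ereal_inf_lbound; exists alpha => //; congr (_ * _)%E.
rewrite -torus_integralZl ?expR_ge0 // => [|z|]; [|exact: powR_ge0|exact: measurable_pseudopoly].
  apply: eq_integral => p _.
  by rewrite expeR_sum_torus_potential // -pseudopoly_powR.
Qed.

(** The bound from the means has N terms; by periodicity each of them
    integrates to the same value as the term with its root at the origin. *)
Lemma pseudopoly_Lnorm_le L N (alpha : 'I_N -> R[i]) b : covolume L = (pi / 2)%:E ->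
  (0 < N)%N -> 0 < b ->
  (torus_Lnorm_pow L b (pseudopoly L alpha) <=
   (pi / 2 * expR (N%:R * b * A_const L))%:E * E_const L (b * N%:R))%E.
Proof.
move=> covL N0 b0.
pose J := torus_integral L (fun z => (sigma_modulus L z `^ (b * N%:R))%:E).
have -> : E_const L (b * N%:R) =
    ((2 / pi)%:E * ((expR (- (N%:R * b * A_const L)))%:E * J))%E.
  congr (_ * _)%E; rewrite -torus_integralZl ?expR_ge0 // => [|z|]; first last.
  - exact: measurableT_comp (@measurable_powR R _) (measurable_sigma_modulus L).
  - exact: powR_ge0.
  apply: eq_integral => p _.
  rewrite expeR_torus_potential ?mulr_gt0 ?ltr0n // subr0 -EFinM mulrC.
  by rewrite [b * N%:R]mulrC.
rewrite pi_expR_cancel.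
pose h (j : 'I_N) (p : plane) := sigma_modulus L (cplx p - alpha j) `^ (b * N%:R).
have mP := measurable_fund_parallelogram L.
have mh j : measurable_fun (fund_parallelogram L : set plane) (fun p => (h j p)%:E).
  by apply: measurable_funTS; apply/measurable_EFinP; exact: measurable_sigma_modulus_shift.
have h0 j p : (0 <= (h j p)%:E)%E by rewrite lee_fin powR_ge0.
have mhN j : measurable_fun (fund_parallelogram L : set plane)
   (fun p => (N%:R^-1)%:E * (h j p)%:E)%E.
  exact: measurable_funeM.
apply: (@le_trans _ _ (\int[area]_(p in fund_parallelogram L)
    (\sum_(j < N) (N%:R^-1)%:E * (h j p)%:E))%E).
  apply: ge0_le_integral => //.
  - by move=> p _; rewrite lee_fin powR_ge0.
  - by apply: measurable_funTS; apply/measurable_EFinP; exact: measurable_pseudopoly.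
  - exact: emeasurable_sum.
  - move=> p _; rewrite (pseudopoly_powR _ _ (cplx p)).
    rewrite (eq_bigr (fun j => (N%:R^-1 * h j p)%:E)) // sumEFin lee_fin.
    apply: (le_trans (prod_le_mean_pow _ _)) => // [j|]; first exact: powR_ge0.
    by apply: ler_sum => j _; rewrite /h powRrM powR_mulrn ?powR_ge0.
rewrite ge0_integral_sum //; last by move=> j p _; rewrite mule_ge0 // lee_fin.
rewrite (eq_bigr (fun=> ((N%:R^-1)%:E * J)%E)) => [|j _].
  rewrite -ge0_sume_distrl; last by move=> j _; rewrite lee_fin.
  rewrite sumEFin sumr_const card_ord -[N%:R^-1 *+ N]mulr_natl mulfV ?mul1e //.
  by rewrite pnatr_eq0 -lt0n.
have := torus_integralZl L (_ : 0 <= N%:R^-1)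
  (fun z => powR_ge0 (sigma_modulus L (z - alpha j)) (b * N%:R))
  (measurable_sigma_modulus_shift L (b * N%:R) (alpha j)).
by rewrite torus_integral_sigma_modulus // => <- //; rewrite invr_ge0.
Qed.

End TorusIntegral.

Theorem proposition2p4p1 (R : realType) (L : lattice R)
    (covolL : covolume L = (pi / 2)%:E)
    (N : nat) (N_ge1 : (1 <= N)%N) (alpha : 'I_N -> complex R)
    (beta : R) (beta_gt0 : 0 < beta) :
  ((pi / 2 * expR (N%:R * beta * A_const L))%:E * packing_number L N beta
     <= torus_Lnorm_pow L beta (pseudopoly L alpha))%E /\
  (torus_Lnorm_pow L beta (pseudopoly L alpha)
     <= (pi / 2 * expR (N%:R * beta * A_const L))%:E
        * E_const L (beta * N%:R))%E.
Proof.
split; first exact: packing_number_le.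
exact: pseudopoly_Lnorm_le.
Qed.
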